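(* Let $n\ge 1$, let $V\in C([0,1];\mathbb{R}^{n\times n})$ be such that $V(x)$ is symmetric for every $x$, and let $\alpha_1,\alpha_2,\beta_1,\beta_2\in\mathbb{R}^{n\times n}$ satisfy $\operatorname{rank}[\alpha_1\ \alpha_2]=\operatorname{rank}[\beta_1\ \beta_2]=n$, $\alpha_1\alpha_2^t-\alpha_2\alpha_1^t=0$ and $\beta_1\beta_2^t-\beta_2\beta_1^t=0$. Let $H$ be the operator $Hy=-y''+V(x)y$ on $(0,1)$ with boundary conditions $\alpha_1y(0)+\alpha_2y'(0)=0$, $\beta_1y(1)+\beta_2y'(1)=0$. Then, for all sufficiently large $\lambda_\infty>0$, with $\Gamma_3$ denoting the path $s=1$, $\lambda$ decreasing from $0$ to $-\lambda_\infty$, $$\operatorname{Mor}(H)=\operatorname{Mas}(\ell,\ell_1;\Gamma_3).$$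
   Context: $\operatorname{Mor}(H)$ is the number of negative eigenvalues of $H$, counted with multiplicity. Superscript $t$ is transpose. Normalization: multiplying $[\alpha_1\ \alpha_2]$ and $[\beta_1\ \beta_2]$ on the left by invertible matrices does not change the boundary conditions, and they are taken normalized so that $\alpha_1\alpha_1^t+\alpha_2\alpha_2^t=I$ and $\beta_1\beta_1^t+\beta_2\beta_2^t=I$. Lagrangian path: with $J=\begin{pmatrix}0&-I_n\\ I_n&0\end{pmatrix}$, a Lagrangian subspace of $\mathbb{R}^{2n}$ is an $n$-dimensional subspace on which $(Jx,y)=0$ for all $x,y$; a frame is a $2n\times n$ matrix whose columns form a basis. For $\lambda\in\mathbb{R}$ let $X(x,\lambda),Z(x,\lambda)$ be the $n\times n$ matrix solutions of $X'=Z$, $Z'=(V(x)-\lambda I)X$ with $X(0,\lambda)=\alpha_2^t$, $Z(0,\lambda)=-\alpha_1^t$. Then $\ell(s,\lambda)$ is the Lagrangian subspace with frame $\binom{X(s,\lambda)}{Z(s,\lambda)}$, and the target $\ell_1$ is the Lagrangian subspace with frame $\binom{\beta_2^t}{-\beta_1^t}$. Maslov index: put $\tilde W_{s,\lambda}=(X+iZ)(X-iZ)^{-1}\big((\beta_1^t\beta_1-\beta_2^t\beta_2)-2i\beta_2^t\beta_1\big)$, evaluated at $(s,\lambda)$, a unitary $n\times n$ matrix with $\dim\ker(\tilde W_{s,\lambda}+I)=\dim(\ell(s,\lambda)\cap\ell_1)$. For a continuous path $\Gamma$ in the $(s,\lambda)$-plane parametrized by $t\in[a,b]$, write $\tilde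 W_t$ for $\tilde W$ at the point with parameter $t$; choose a partition $a=t_0<\dots<t_N=b$ and $\epsilon_j\in(0,\pi)$ with $e^{i(\pi\pm\epsilon_j)}\notin\sigma(\tilde W_t)$ for $t\in[t_{j-1},t_j]$, set $k(t,\epsilon_j)=\sum_{0\le\theta<\epsilon_j}\dim\ker(\tilde W_t-e^{i(\pi+\theta)}I)$, and define $\operatorname{Mas}(\ell,\ell_1;\Gamma)=\sum_{j=1}^N\big(k(t_j,\epsilon_j)-k(t_{j-1},\epsilon_j)\big)$. *)

(* Defs.v *)
From HB Require Import structures.
From mathcomp Require Import all_boot all_order all_algebra.
From mathcomp Require Import complex.
From mathcomp Require Import all_classical all_reals all_analysis.
Set Implicit Arguments.
Unset Strict Implicit.
Unset Printing Implicit Defensive.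
Import Order.TTheory GRing.Theory Num.Theory.
Import numFieldNormedType.Exports.
Local Open Scope classical_set_scope.
Local Open Scope ring_scope.

(* Real functions on [0,1] are represented by total functions on R, of which
   only the values on [0,1] matter. *)

Section SchrodingerOperator.
Variables (R : realType) (n : nat).
Implicit Types (y z w f : R -> 'cV[R]_n).

Definition L2_01 w : Prop := forall i,
  measurable_fun `[(0 : R), 1] (fun x => w x i 0) /\
  lebesgue_measure.-integrable `[(0 : R), 1] (EFin \o (fun x => w x i 0 ^+ 2)).

(* y is the continuously differentiable representative of an element of
   H^2((0,1); R^n), z = y' (extended by continuity to the endpoints), and
   w = y'' is its second weak derivative. *)
Definition H2_01 y z w : Prop :=
  [/\ {within `[(0 : R), 1], continuous y},
      {within `[(0 : R), 1], continuous z},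
      (forall x, x \in `](0 : R), 1[ -> is_derive x 1 y (z x)),
      L2_01 w &
      (forall x i, x \in `[(0 : R), 1] ->
         z x i 0 =
         z 0 i 0 + \int[lebesgue_measure]_(t in `[(0 : R), x]) w t i 0)].

(* The graph of H in L^2((0,1); R^n): y lies in the domain of H and H y = f
   almost everywhere. *)
Definition schrodinger (V : R -> 'M[R]_n) (a1 a2 b1 b2 : 'M[R]_n) y f : Prop :=
  exists z w,
    [/\ H2_01 y z w,
        a1 *m y 0 + a2 *m z 0 = 0,
        b1 *m y 1 + b2 *m z 1 = 0 &
        {ae lebesgue_measure, forall x, x \in `[(0 : R), 1] ->
           f x = - w x + V x *m y x}].

End SchrodingerOperator.

Section MorseIndex.
Variables (R : realType) (n : nat).
(* the graph of an operator on functions on [0,1] *)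
Variable H : (R -> 'cV[R]_n) -> (R -> 'cV[R]_n) -> Prop.

Definition eigenfunction (lam : R) (y : R -> 'cV[R]_n) : Prop :=
  H y (fun x => lam *: y x).

(* Domains consist of continuous functions, so that nonzero in L^2 means
   nonzero at some point. *)
Definition is_eigenvalue (lam : R) : Prop :=
  exists2 y, eigenfunction lam y & exists2 x, x \in `[0, 1] & y x != 0.

Definition has_multiplicity (lam : R) (d : nat) : Prop :=
  exists u : 'I_d -> R -> 'cV[R]_n,
    [/\ (forall i, eigenfunction lam (u i)),
        (forall c : 'I_d -> R,
           (forall x, x \in `[0, 1] -> \sum_i c i *: u i x = 0) ->
           forall i, c i = 0) &
        (forall y, eigenfunction lam y ->
           exists c : 'I_d -> R,
             forall x, x \in `[0, 1] -> y x = \sum_i c i *: u i x)].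

Definition is_morse_index (m : nat) : Prop :=
  exists (s : seq R) (d : R -> nat),
    [/\ uniq s,
        (forall lam, lam \in s <-> lam < 0 /\ is_eigenvalue lam),
        (forall lam, lam \in s -> has_multiplicity lam (d lam)) &
        m = (\sum_(lam <- s) d lam)%N].

End MorseIndex.

Section MaslovIndex.
Variables (R : realType) (n : nat).

(* kermx is the row kernel, hence the transpose. *)
Definition dim_ker (A : 'M[R[i]]_n) : nat := \rank (kermx A^T).

Definition expi (t : R) : R[i] := (cos t +i* sin t)%C.

(* Only finitely many terms of this sum are nonzero when e <= 2 pi. *)
Definition maslov_count (A : 'M[R[i]]_n) (e : R) : int :=
  \sum_(theta \in [set theta : R | 0 <= theta < e])
     (dim_ker (A - (expi (pi + theta))%:M))%:Z.

Definition maslov_partition (W : R -> 'M[R[i]]_n) (a b : R) (N : nat) (t e : nat -> R) : Prop :=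
  [/\ t 0%N = a, t N = b &
      forall j, (j < N)%N ->
        [/\ t j < t j.+1, 0 < e j < pi &
            forall s, t j <= s <= t j.+1 ->
              ~~ eigenvalue (W s) (expi (pi + e j)) /\
              ~~ eigenvalue (W s) (expi (pi - e j))]].

Definition maslov_sum (W : R -> 'M[R[i]]_n) (N : nat) (t e : nat -> R) : int :=
  \sum_(j < N) (maslov_count (W (t j.+1)) (e j) - maslov_count (W (t j)) (e j)).

(* The Maslov index is m: it can be computed from some choice of partition,
   and every such choice yields m. *)
Definition is_maslov_index (W : R -> 'M[R[i]]_n) (a b : R) (m : int) : Prop :=
  (exists N t e, maslov_partition W a b N t e) /\
  (forall N t e, maslov_partition W a b N t e -> maslov_sum W N t e = m).

End MaslovIndex.

Section LagrangianPath.
Variables (R : realType) (n : nat).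

Definition frame_solution (V : R -> 'M[R]_n) (a1 a2 : 'M[R]_n) (lam : R)
    (X Z : R -> 'M[R]_n) : Prop :=
  [/\ {within `[(0 : R), 1], continuous X},
      {within `[(0 : R), 1], continuous Z},
      (forall x, x \in `](0 : R), 1[ ->
         is_derive x 1 X (Z x) /\
         is_derive x 1 Z ((V x - lam%:M) *m X x)),
      X 0 = a2^T &
      Z 0 = - a1^T].

Definition cmx (A : 'M[R]_n) : 'M[R[i]]_n := map_mx (real_complex R) A.

(* The unitary matrix attached to the Lagrangian subspaces with frames
   (X; Z) and (b2^T; - b1^T), under the normalization
   b1 b1^T + b2 b2^T = 1. *)
Definition maslov_matrix (b1 b2 X Z : 'M[R]_n) : 'M[R[i]]_n :=
  (cmx X + 'i%C *: cmx Z) *m invmx (cmx X - 'i%C *: cmx Z) *m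
  (cmx (b1^T *m b1 - b2^T *m b2) - (2 * 'i%C) *: cmx (b2^T *m b1)).

(* The matrix along a path Gamma in the (s, lambda)-plane. *)
Definition path_matrix (b1 b2 : 'M[R]_n) (X Z : R -> R -> 'M[R]_n)
    (Gamma : R -> R * R) (t : R) : 'M[R[i]]_n :=
  maslov_matrix b1 b2 (X (Gamma t).1 (Gamma t).2) (Z (Gamma t).1 (Gamma t).2).

(* For t in [0, L], the path s = 1 with lambda decreasing from 0 to - L. *)
Definition Gamma3 (t : R) : R * R := (1, - t).

End LagrangianPath.

(* Main.v *)
Require Import Defs.
From HB Require Import structures.
From mathcomp Require Import all_boot all_order all_algebra.
From mathcomp Require Import complex.
From mathcomp Require Import all_classical all_reals all_analysis.
From mathcomp Require Import measurable_realfun.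
From mathcomp Require Import ring lra zify.
Set Implicit Arguments.
Unset Strict Implicit.
Unset Printing Implicit Defensive.
Import Order.TTheory GRing.Theory Num.Theory.
Import numFieldNormedType.Exports.
Local Open Scope ring_scope.

(** Both sides count, with multiplicity, the lam < 0 at which the matrix
D(lam) = b1 X(1, lam) + b2 Z(1, lam) is singular.

On the side of the operator, the boundary condition at 0 and uniqueness for the
initial value problem make every eigenfunction equal to X(., lam) v for one
vector v, and the boundary condition at 1 then reads D(lam) v = 0
([eigenfunction_frame], [frame_eigenfunction]). Hence the multiplicity of lam is
the corank of D(lam). The spectrum is bounded below
([spectrum_bounded_below]), so that the sum over lam < 0 only concerns a bounded
interval of values of lam.

On the Maslov side put P(lam) = b2 X(1, lam) - b1 Z(1, lam); then (P, D) is the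
frame of l(1, lam) in symplectic coordinates in which the target l1 is the
horizontal plane, and the unitary matrix W is conjugate to
- (P + i D) (P - i D)^-1. The eigenspace of W for e^{i (pi + theta)} thus has the
dimension of the kernel of the real matrix
cos (theta / 2) D - sin (theta / 2) P ([rank_maslov_matrix]). If e^{i (pi + e)} is
not an eigenvalue, E = cos (e / 2) D - sin (e / 2) P is invertible,
S = - D E^-1 is a real symmetric matrix, and the angle theta corresponds to the
eigenvalue sin (theta / 2) / sin ((e - theta) / 2) of S. As theta runs through
[0, e) this quantity runs once through [0, +oo), so the number k(t, e) is the number
of nonnegative eigenvalues of S ([maslov_count_chart]), while the kernel of S has
the dimension of the kernel of D.

The sign of the crossings comes from the Wronskian identity
  X_mu^T Z_lam - Z_mu^T X_lam = (mu - lam) int_0^1 X_mu^T X_lam,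
which gives
  S(mu) - S(lam) = - (mu - lam) sin (e / 2) E_mu^-T (int_0^1 X_mu^T X_lam) E_lam^-1.
For mu close to lam the integral is close to the positive definite matrix
int_0^1 X_lam^T X_lam, so that S increases strictly as lam decreases. Comparing
dimensions of subspaces on which the forms have a sign ([inertia_jump]) shows that
the number of nonnegative eigenvalues is locally constant after t = - lam and
increases by exactly dim ker S(t) when t is reached ([count_step]). Gluing these
local statements along [0, L] ([interval_induction]) shows that there are finitely
many crossings, that admissible partitions exist, and that the sum attached to any of
them is the sum of the coranks of D(- t) over 0 < t <= L, hence the Morse index. *)

(** * Real symmetric matrices *)

Section RealSpectral.
Variable R : rcfType.

Definition qform n (S : 'M[R]_n) (u : 'rV[R]_n) : R := (u *m S *m u^T) 0 0.

Lemma qform1E n (u : 'rV[R]_n) : qform 1%:M u = \sum_i u 0 i ^+ 2.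
Proof. by rewrite /qform mulmx1 mxE; apply: eq_bigr => i _; rewrite mxE. Qed.

Lemma qform1_ge0 n (u : 'rV[R]_n) : 0 <= qform 1%:M u.
Proof. by rewrite qform1E; apply: sumr_ge0 => i _; rewrite sqr_ge0. Qed.

Lemma qform1_eq0 n (u : 'rV[R]_n) : (qform 1%:M u == 0) = (u == 0).
Proof.
rewrite qform1E psumr_eq0; last by move=> i _; rewrite sqr_ge0.
apply/allP/eqP => [u0|-> i _]; last by rewrite /= mxE expr0n eqxx.
apply/rowP => i; rewrite mxE; apply/eqP.
by have := u0 i (mem_index_enum i); rewrite /= sqrf_eq0.
Qed.

Lemma qform1_gt0 n (u : 'rV[R]_n) : (0 < qform 1%:M u) = (u != 0).
Proof. by rewrite lt_neqAle qform1_ge0 eq_sym qform1_eq0 andbT. Qed.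

Lemma qformB n (S T : 'M[R]_n) u : qform (S - T) u = qform S u - qform T u.
Proof. by rewrite /qform mulmxBr mulmxBl !mxE. Qed.

(** Over R[i] an eigenvalue a with eigenvector v exists; computing v S v^* in two
ways gives a = a^*, and the characteristic polynomial of S, having the real root a
over R[i], has it over R. *)
Lemma symmetric_eigenvalue n (S : 'M[R]_n.+1) : S^T = S ->
  exists s, eigenvalue S s.
Proof.
move=> Ssym; pose T := map_mx (real_complex R) S.
have [a /eigenvalueP[v vT v0]] := @eigenvalue_closed R[i] _ T isT.
(* vc is the entrywise conjugate of v, an eigenvector for a^* *)
pose vc := map_mx (fun z : R[i] => z^*) v.
have TT : T^T = T by rewrite /T map_trmx Ssym.
have Tc : map_mx (fun z : R[i] => z^*) T = T.
  by apply/matrixP => i j; rewrite !mxE; apply/eqP; rewrite eq_complex /= oppr0 !eqxx.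
have vv : (v *m vc^T) 0 0 != 0.
  rewrite mxE psumr_eq0; last by move=> i _; rewrite !mxE mul_conjC_ge0.
  apply: contra v0 => /allP vi; apply/eqP/rowP => i; rewrite mxE; apply/eqP.
  by have := vi i (mem_index_enum i); rewrite /= !mxE mul_conjC_eq0.
have vcT : vc *m T = a^* *: vc.
  rewrite -[X in vc *m X]Tc -map_mxM vT; apply/matrixP => i j.
  by rewrite !mxE rmorphM.
have aa : a = a^*.
  have : (v *m T *m vc^T) 0 0 = (v *m (vc *m T)^T) 0 0.
    by rewrite trmx_mul TT mulmxA.
  rewrite vT vcT linearZ /= -scalemxAl -scalemxAr !(mxE,mxE addmx_key) => /eqP.
  rewrite -subr_eq0 -mulrBl mulf_eq0 subr_eq0 => /orP[/eqP//|].
  by move: vv; rewrite mxE => /negPf ->.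
exists (complex.Re a).
have ar : a = (complex.Re a)%:C%C.
  by case: a aa {vT vcT} => x y /= [] yy; congr (_ +i* _)%C; lra.
move: (ar) vT => -> vT; rewrite eigenvalue_root_char.
have : eigenvalue T (complex.Re a)%:C%C by apply/eigenvalueP; exists v.
by rewrite eigenvalue_root_char /T -map_char_poly fmorph_root.
Qed.

(** The reflection exchanging v with a basis vector; conjugating by it splits off the
eigenvector v in the induction of [symmetric_spectral]. *)
Lemma householder n (v : 'rV[R]_n) (k : 'I_n) : qform 1%:M v = 1 ->
  exists H : 'M[R]_n, [/\ H^T = H, H *m H = 1%:M & delta_mx 0 k *m H = v].
Proof.
move=> v1; have [->|ve] := eqVneq v (delta_mx 0 k).
  by exists 1%:M; rewrite trmx1 !mulmx1.
set e := delta_mx 0 k in ve *; pose w := v - e.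
have w0 : qform 1%:M w != 0 by rewrite qform1_eq0 subr_eq0.
have e1 : qform 1%:M e = 1.
  rewrite qform1E (bigD1 k) //= big1 ?addr0 ?mxE ?eqxx ?expr1n //.
  by move=> i /negPf ik; rewrite mxE ik andbF expr0n.
have we : qform 1%:M w = - 2 * (w *m e^T) 0 0.
  have wT : w^T = v^T - e^T by rewrite /w linearB.
  move: v1 e1; rewrite /qform !mulmx1 wT /w !mulmxBl !mulmxBr.
  have -> : e *m v^T = (v *m e^T)^T by rewrite trmx_mul trmxK.
  rewrite !mxE => -> ->.
  set x := \sum_j _.
  by ring.
pose c := 2 / qform 1%:M w.
have wwT : w *m w^T = (qform 1%:M w)%:M.
  by rewrite /qform mulmx1 [LHS]mx11_scalar.
exists (1%:M - c *: (w^T *m w)); split.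
- by rewrite linearB /= trmx1 linearZ /= trmx_mul trmxK.
- set N := w^T *m w.
  have NN : N *m N = qform 1%:M w *: N.
    by rewrite /N mulmxA -[w^T *m w *m _]mulmxA wwT mul_mx_scalar -scalemxAl.
  rewrite mulmxBl !mulmxBr !mul1mx mulmx1 -!scalemxAl -!scalemxAr NN !scalerA.
  have -> : c * c * qform 1%:M w = c + c by rewrite /c; field.
  by rewrite scalerDl opprB addrK subrK.
rewrite mulmxBr mulmx1 -scalemxAr mulmxA.
have -> : e *m w^T = ((w *m e^T) 0 0)%:M.
  by rewrite -[LHS]trmxK trmx_mul trmxK {1}[w *m _]mx11_scalar tr_scalar_mx.
rewrite mul_scalar_mx scalerA /c we.
have we0 : (w *m e^T) 0 0 != 0 by apply: contraNneq w0 => h; rewrite we h mulr0.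
have -> : 2 / (-2 * (w *m e^T) 0 0) * (w *m e^T) 0 0 = -1 by field.
by rewrite scaleN1r opprK /w addrC subrK.
Qed.

Definition spectral_decomposition n (S Q : 'M[R]_n) (d : 'rV[R]_n) : Prop :=
  Q *m Q^T = 1%:M /\ S = Q^T *m diag_mx d *m Q.

Lemma symmetric_spectral n (S : 'M[R]_n) : S^T = S ->
  exists Q d, spectral_decomposition S Q d.
Proof.
elim: n S => [|n IH] S Ssym.
  by exists 1%:M, 0; split; apply/matrixP => -[].
have [s /eigenvalueP[v vS v0]] := symmetric_eigenvalue Ssym.
pose v' := (Num.sqrt (qform 1%:M v))^-1 *: v.
have v1 : qform 1%:M v' = 1.
  rewrite /qform mulmx1 /v' linearZ /= -scalemxAl -scalemxAr scalerA !mxE.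
  have := qform1_gt0 v; rewrite v0 => v_gt0.
  have -> : \sum_j v 0 j * v^T j 0 = qform 1%:M v by rewrite /qform mulmx1 mxE.
  rewrite -expr2 exprVn sqr_sqrtr ?ltW //. 
  by rewrite mulVf // gt_eqF.
have v'S : v' *m S = s *: v' by rewrite /v' -scalemxAl vS scalerA mulrC -scalerA.
have [H [HT HH eH]] := householder 0 v1.
pose T := H *m S *m H.
have TT : T^T = T by rewrite /T !trmx_mul HT Ssym mulmxA.
have eT : delta_mx 0 0 *m T = s *: delta_mx 0 0 :> 'rV_n.+1.
  by rewrite /T !mulmxA eH v'S -eH -!scalemxAl -mulmxA HH mulmx1.
have SE : S = H *m T *m H by rewrite /T !mulmxA HH mul1mx -mulmxA HH mulmx1.
clearbody T.
pose T1 := drsubmx (T : 'M[R]_(1 + n)).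
have Tblock : T = block_mx s%:M 0 0 T1 :> 'M[R]_(1 + n).
  rewrite -[LHS](@submxK _ 1 n 1 n).
  have T0 j : T 0 j = s *+ (0 == j).
    have /rowP/(_ j) := eT; rewrite -rowE !mxE /= => ->.
    by rewrite eq_sym; case: eqP => _; rewrite ?mulr1 ?mulr0.
  have lst : forall k, lshift n (k : 'I_1) = 0 by move=> k; apply/val_inj; rewrite /= ord1.
  congr block_mx; apply/matrixP => i j; rewrite !mxE ?lst ?T0 ?lst.
  - by rewrite !ord1.
  - by [].
  - by rewrite -[T]TT mxE T0.
have T1sym : T1^T = T1 by rewrite /T1 trmx_drsub TT.
have [Q1 [d1 [Q1Q1 T1E]]] := IH T1 T1sym.
pose Q : 'M[R]_(1 + n) := block_mx 1%:M 0 0 Q1.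
have QQ : Q *m Q^T = 1%:M.
  rewrite /Q tr_block_mx mulmx_block !trmx0 !trmx1 !mulmx0 !mul0mx !mulmx1 Q1Q1.
  by rewrite !addr0 add0r -scalar_mx_block.
pose d : 'rV_(1 + n) := row_mx s%:M d1.
have TQ : T = Q^T *m diag_mx d *m Q.
  rewrite Tblock /d diag_mx_row /Q tr_block_mx !mulmx_block.
  rewrite !trmx0 !trmx1 !(mulmx0, mul0mx, mulmx1, mul1mx, addr0, add0r) -T1E.
  suff -> : diag_mx (s%:M : 'rV_1) = s%:M by [].
  by apply/matrixP => i j; rewrite !ord1 !mxE.
exists (Q *m H), d; split.
  by rewrite trmx_mul mulmxA -[Q *m H *m _]mulmxA HT HH mulmx1.
by rewrite SE TQ trmx_mul HT !mulmxA.
Qed.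

End RealSpectral.

(** * Inertia and its variation *)

Section Inertia.
Variable R : rcfType.

(** The rank is read off after compressing the diagonal matrix to its support. *)
Lemma rank_diag_mx n (d : 'rV[R]_n) :
  \rank (diag_mx d) = #|[set i | d 0 i != 0]|.
Proof.
set A := [set i | _]; pose f (k : 'I_#|A|) := enum_val k.
pose N : 'M[R]_(#|A|, n) := rowsub f 1%:M.
have NM m (M : 'M[R]_(n, m)) : N *m M = rowsub f M by rewrite /N mul_rowsub_mx mul1mx.
apply/eqP; rewrite eqn_leq; apply/andP; split.
  have -> : diag_mx d = N^T *m (N *m diag_mx d).
    apply/matrixP => i j; rewrite NM !mxE.
    have [iA|] := boolP (i \in A); last first.
      rewrite inE negbK => /eqP di.
      rewrite di mul0rn big1 // => k _; rewrite !mxE.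
      case: eqP => [fk|_]; last by rewrite mul0r.
      by have := enum_valP k; rewrite inE -/(f k) fk di eqxx.
    rewrite (bigD1 (enum_rank_in iA i)) //= !mxE /f enum_rankK_in // eqxx mul1r.
    rewrite big1 ?addr0 // => k ki; rewrite !mxE.
    case: eqP => [fk|_]; last by rewrite mul0r.
    by case/eqP: ki; apply: enum_val_inj; rewrite enum_rankK_in.
  exact: mulmx_max_rank.
have NdN : N *m diag_mx d *m N^T = diag_mx (\row_k d 0 (f k)).
  apply/matrixP => i j; rewrite NM !mxE (bigD1 (f i)) //= !mxE eqxx mulr1n.
  rewrite big1 ?addr0 => [|k ki]; last by rewrite !mxE eq_sym (negPf ki) mulr0n mul0r.
  by rewrite (inj_eq enum_val_inj) eq_sym; case: eqP => _; rewrite ?mulr1 ?mulr0.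
have NdNu : diag_mx (\row_k d 0 (f k)) \in unitmx.
  rewrite unitmxE det_diag unitfE prodf_seq_neq0; apply/allP => k _ /=.
  by rewrite mxE; have := enum_valP k; rewrite inE.
rewrite -[X in (X <= _)%N](mxrank_unit NdNu) -NdN.
by apply: leq_trans (mxrankM_maxl _ _) (mxrankM_maxr _ _).
Qed.

Definition nb_nonneg n (d : 'rV[R]_n) : nat := #|[set i | 0 <= d 0 i]|.
Definition nb_zero n (d : 'rV[R]_n) : nat := #|[set i | d 0 i == 0]|.
Definition nb_pos n (d : 'rV[R]_n) : nat := #|[set i | 0 < d 0 i]|.
Definition nb_neg n (d : 'rV[R]_n) : nat := #|[set i | d 0 i < 0]|.

Lemma nb_nonnegE n (d : 'rV[R]_n) : nb_nonneg d = (nb_pos d + nb_zero d)%N.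
Proof.
rewrite /nb_nonneg /nb_pos /nb_zero -cardsUI -[LHS]addn0; congr (_ + _)%N.
  by apply: eq_card => i; rewrite !inE le_eqVlt orbC eq_sym.
apply/esym/eqP; rewrite cards_eq0; apply/eqP/setP => i; rewrite !inE.
by case: ltgtP.
Qed.

Lemma nb_negE n (d : 'rV[R]_n) : (nb_neg d + nb_nonneg d)%N = n.
Proof.
rewrite /nb_nonneg /nb_neg -[RHS](card_ord n) -(cardsC [set i | d 0 i < 0]).
by congr (_ + _)%N; apply: eq_card => i; rewrite !inE leNgt.
Qed.

Section Decomposition.
Variables (n : nat) (S Q : 'M[R]_n) (d : 'rV[R]_n).
Hypothesis SQd : spectral_decomposition S Q d.

Lemma spectral_trmxK : Q^T *m Q = 1%:M.
Proof. by have [QQ _] := SQd; apply: mulmx1C. Qed.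

Lemma qform_spectral u : qform S u = \sum_i d 0 i * (u *m Q^T) 0 i ^+ 2.
Proof.
have [_ ->] := SQd; rewrite /qform !mulmxA -mulmxA -{2}[Q]trmxK -trmx_mul.
rewrite mxE; apply: eq_bigr => i _.
by rewrite mul_mx_diag !mxE; ring.
Qed.

Lemma qform1_spectral u : qform 1%:M u = \sum_i (u *m Q^T) 0 i ^+ 2.
Proof.
rewrite -qform1E /qform !mulmx1 trmx_mul trmxK mulmxA -[_ *m _ *m Q]mulmxA.
by rewrite spectral_trmxK mulmx1.
Qed.

Lemma corank_spectral s :
  (n - \rank (S - s%:M)%R)%N = #|[set i | d 0 i == s]|.
Proof.
have -> : S - s%:M = Q^T *m diag_mx (\row_i (d 0 i - s)) *m Q.
  have -> : diag_mx (\row_i (d 0 i - s)) = diag_mx d - s%:M.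
    by apply/matrixP => i j; rewrite !mxE; case: eqP => _; rewrite ?subr0.
  rewrite mulmxBr mulmxBl mul_mx_scalar -scalemxAl spectral_trmxK scalemx1.
  by have [_ <-] := SQd.
have [Qu _] := mulmx1_unit SQd.1; have Qtu : Q^T \in unitmx by rewrite unitmx_tr.
rewrite mxrankMfree ?row_free_unit // -mxrank_tr trmx_mul trmxK.
rewrite mxrankMfree ?row_free_unit // tr_diag_mx rank_diag_mx.
rewrite -{1}(card_ord n) -(cardsC [set i | d 0 i == s]) -[X in _ = X]addn0.
have -> : ~: [set i | d 0 i == s] = [set i | (\row_i0 (d 0 i0 - s)) 0 i != 0].
  by apply/setP => i; rewrite !inE mxE subr_eq0.
by rewrite addnK addn0.
Qed.

End Decomposition.

(** A vector u whose coordinates u Q^T vanish outside A lies in the span of the rows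
of Q indexed by A. Two such spans meeting only in 0 have dimensions of sum at most
n. *)
Lemma disjoint_spans n (Q Q' : 'M[R]_n) (A B : {set 'I_n}) :
    Q *m Q^T = 1%:M -> Q' *m Q'^T = 1%:M ->
    (forall u : 'rV_n, u != 0 ->
       (forall i, i \notin A -> (u *m Q^T) 0 i = 0) ->
       (forall i, i \notin B -> (u *m Q'^T) 0 i = 0) -> False) ->
  (#|A| + #|B| <= n)%N.
Proof.
move=> QQ QQ' AB.
pose M (C : {set 'I_n}) (P : 'M[R]_n) := rowsub (fun k : 'I_#|C| => enum_val k) P.
have MM C P : P *m P^T = 1%:M -> \rank (M C P) = #|C|.
  move=> PP; apply/eqP; rewrite eqn_leq rank_leq_row /=.
  have MT : M C P *m (M C P)^T = 1%:M.
    apply/matrixP => i j; have /matrixP/(_ (enum_val i) (enum_val j)) := PP.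
    rewrite !mxE (inj_eq enum_val_inj) => <-.
    by apply: eq_bigr => k _; rewrite !mxE.
  by rewrite -[X in (X <= _)%N](@mxrank1 R) -MT mxrankM_maxl.
have Mu C P (u : 'rV_n) : P *m P^T = 1%:M -> (u <= M C P)%MS ->
    forall i, i \notin C -> (u *m P^T) 0 i = 0.
  move=> PP /submxP[c ->] i iC; rewrite -mulmxA mul_rowsub_mx PP mxE big1 // => k _.
  rewrite !mxE; case: eqP => [ki|_]; last by rewrite mulr0.
  by move: iC; rewrite -ki enum_valP.
rewrite -(MM A Q) // -(MM B Q') // -mxrank_sum_cap.
have -> : \rank (M A Q :&: M B Q')%MS = 0%N.
  apply/eqP; rewrite mxrank_eq0; apply/rowV0P => u; rewrite sub_capmx => /andP[uA uB].
  by apply/eqP/negP => /negP u0; apply: (AB u u0); [exact: Mu uA|exact: Mu uB].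
by rewrite addn0 rank_leq_col.
Qed.

Definition posdef n (K : 'M[R]_n) := forall u : 'rV_n, u != 0 -> 0 < qform K u.

Lemma sum_sqr_gt0 n (x : 'rV[R]_n) : x != 0 -> 0 < \sum_i x 0 i ^+ 2.
Proof. by rewrite -qform1_gt0 qform1E. Qed.

Lemma mul_orthT_neq0 n (u : 'rV[R]_n) (Q : 'M[R]_n) : Q *m Q^T = 1%:M ->
  u != 0 -> u *m Q^T != 0.
Proof.
move=> QQ; apply: contraNneq => /(congr1 (mulmx^~ Q)).
by rewrite mul0mx -mulmxA (mulmx1C QQ) mulmx1 => ->.
Qed.

(** On the span of the eigenvectors of S with nonnegative eigenvalues the form of S'
is positive, so this span meets that of the other eigenvectors of S' only in 0. *)
Lemma nb_nonneg_le_pos n (S Q S' Q' : 'M[R]_n) d d' :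
    spectral_decomposition S Q d -> spectral_decomposition S' Q' d' ->
    posdef (S' - S) -> (nb_nonneg d <= nb_pos d')%N.
Proof.
move=> SQd SQd' SS'.
suff : (nb_nonneg d + #|[set i | (d' 0 i <= 0)%R]| <= n)%N.
  have : (nb_pos d' + #|[set i | (d' 0 i <= 0)%R]| = n)%N.
    rewrite -[RHS](card_ord n) -(cardsC [set i | 0 < d' 0 i]); congr (_ + _)%N.
    by apply: eq_card => i; rewrite !inE leNgt.
  lia.
apply: (disjoint_spans (proj1 SQd) (proj1 SQd')) => u u0 uA uB.
have := SS' u u0; rewrite qformB (qform_spectral SQd) (qform_spectral SQd').
apply/negP; rewrite -leNgt subr_le0; apply: (@le_trans _ _ 0).
  apply: sumr_le0 => i _; case: (lerP (d' 0 i) 0) => di.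
    by rewrite mulr_le0_ge0 // sqr_ge0.
  by rewrite uB ?expr0n ?mulr0 // inE -ltNge.
apply: sumr_ge0 => i _; case: (lerP 0 (d 0 i)) => di.
  by rewrite mulr_ge0 // sqr_ge0.
by rewrite uA ?expr0n ?mulr0 // inE -ltNge.
Qed.

(** Including 1 in the minimum keeps it positive when all the entries vanish. *)
Lemma spectral_gap n (d : 'rV[R]_n) : exists2 c : R, 0 < c &
  forall i, d 0 i != 0 -> c <= `|d 0 i|.
Proof.
exists (\big[Order.min/1]_(i | d 0 i != 0) `|d 0 i|).
  by elim/big_ind: _ => // [x y x0 y0|i]; rewrite ?lt_min ?x0 ?y0 ?normr_gt0.
by move=> i di; rewrite (bigD1 i) //= ge_min lexx.
Qed.

(** The form of S is at least c |u|^2 on the span of the eigenvectors with positive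
eigenvalues, at most - c |u|^2 on the negative ones, and a perturbation by c / 2
preserves the signs. *)
Lemma inertia_lower_semicontinuous n (S Q : 'M[R]_n) d : spectral_decomposition S Q d ->
  exists2 c : R, 0 < c & forall S' Q' d', spectral_decomposition S' Q' d' ->
    (forall u, `|qform (S' - S) u| <= c * qform 1%:M u) ->
    (nb_pos d <= nb_pos d')%N /\ (nb_neg d <= nb_neg d')%N.
Proof.
move=> SQd; have [c c0 cd] := spectral_gap d; exists (c / 2).
  by rewrite divr_gt0.
move=> S' Q' d' SQd' near.
split.
- suff : (nb_pos d + #|[set i | (d' 0 i <= 0)%R]| <= n)%N.
    have : (nb_pos d' + #|[set i | (d' 0 i <= 0)%R]| = n)%N.
      rewrite -[RHS](card_ord n) -(cardsC [set i | 0 < d' 0 i]); congr (_ + _)%N.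
      by apply: eq_card => i; rewrite !inE leNgt.
    lia.
  apply: (disjoint_spans (proj1 SQd) (proj1 SQd')) => u u0 uA uB.
  have := near u; rewrite ler_norml => /andP[+ _].
  rewrite qformB (qform1_spectral SQd).
  have : qform S' u <= 0.
    rewrite (qform_spectral SQd'); apply: sumr_le0 => i _.
    case: (lerP (d' 0 i) 0) => di; first by rewrite mulr_le0_ge0 // sqr_ge0.
    by rewrite uB ?expr0n ?mulr0 // inE -ltNge.
  have : c * \sum_i (u *m Q^T) 0 i ^+ 2 <= qform S u.
    rewrite (qform_spectral SQd) mulr_sumr; apply: ler_sum => i _.
    case: (ltrP 0 (d 0 i)) => di.
      by apply: ler_wpM2r; rewrite ?sqr_ge0 // -[d 0 i]gtr0_norm // cd // gt_eqF.
    by rewrite uA ?expr0n ?mulr0 // inE -leNgt.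
  have : 0 < c * \sum_i (u *m Q^T) 0 i ^+ 2.
    by rewrite mulr_gt0 // sum_sqr_gt0 // mul_orthT_neq0 // (proj1 SQd).
  rewrite mulrAC; lra.
- suff : (nb_neg d + #|[set i | (0 <= d' 0 i)%R]| <= n)%N.
    by have := nb_negE d'; rewrite -/(nb_nonneg d'); lia.
  apply: (disjoint_spans (proj1 SQd) (proj1 SQd')) => u u0 uA uB.
  have := near u; rewrite ler_norml => /andP[_].
  rewrite qformB (qform1_spectral SQd).
  have : 0 <= qform S' u.
    rewrite (qform_spectral SQd'); apply: sumr_ge0 => i _.
    case: (lerP 0 (d' 0 i)) => di; first by rewrite mulr_ge0 // sqr_ge0.
    by rewrite uB ?expr0n ?mulr0 // inE -ltNge.
  have : c * \sum_i (u *m Q^T) 0 i ^+ 2 <= - qform S u.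
    rewrite (qform_spectral SQd) mulr_sumr -sumrN; apply: ler_sum => i _.
    case: (ltrP (d 0 i) 0) => di.
      by rewrite -mulNr; apply: ler_wpM2r; rewrite ?sqr_ge0 // -[- d 0 i]ltr0_norm // cd // lt_eqF.
    by rewrite uA ?expr0n ?mulr0 ?oppr0 // inE -leNgt.
  have : 0 < c * \sum_i (u *m Q^T) 0 i ^+ 2.
    by rewrite mulr_gt0 // sum_sqr_gt0 // mul_orthT_neq0 // (proj1 SQd).
  rewrite mulrAC; lra.
Qed.

(** A small positive perturbation makes the kernel of S positive and leaves the number
of nonnegative eigenvalues unchanged; a small negative one makes the kernel negative,
and that number drops by dim ker S. *)
Lemma inertia_jump n (S Q : 'M[R]_n) d : spectral_decomposition S Q d ->
  exists2 c : R, 0 < c & forall S' Q' d', spectral_decomposition S' Q' d' ->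
    (forall u, `|qform (S' - S) u| <= c * qform 1%:M u) ->
    (posdef (S' - S) -> nb_nonneg d' = nb_nonneg d /\ nb_zero d' = 0%N) /\
    (posdef (S - S') -> nb_nonneg d = (nb_nonneg d' + nb_zero d)%N /\ nb_zero d' = 0%N).
Proof.
move=> SQd; have [c c0 cS] := inertia_lower_semicontinuous SQd; exists c => // S' Q' d' SQd' near.
have [pp nn] := cS _ _ _ SQd' near.
have := nb_negE d; have := nb_negE d'.
have := nb_nonnegE d; have := nb_nonnegE d'.
split=> pd.
- have := nb_nonneg_le_pos SQd SQd' pd; lia.
- have := nb_nonneg_le_pos SQd' SQd pd; lia.
Qed.

End Inertia.

(** * Gluing local statements along a segment *)

Local Open Scope classical_set_scope.
Local Open Scope ring_scope.

(** Compactness of [a, b] for a property of subintervals: the supremum of the points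
reached from a is reached, and it cannot be smaller than b. *)
Lemma interval_induction (R : realType) (Q : R -> R -> Prop) (a b : R) :
    a <= b ->
    (forall x y z, a <= x -> x <= y -> y <= z -> z <= b ->
       Q x y -> Q y z -> Q x z) ->
    (forall t, a <= t <= b -> exists2 e, 0 < e &
       (forall x, t <= x < t + e -> x <= b -> Q t x) /\
       (forall x, t - e < x <= t -> a <= x -> Q x t)) ->
  Q a b.
Proof.
move=> ab Qtrans Qloc; pose A := [set x | a <= x <= b /\ Q a x].
have Aa : A a.
  split; first by rewrite lexx.
  have [|e e0 [+ _]] := Qloc a; first by rewrite lexx.
  by apply=> //; rewrite lexx ltrDl.
have supA : has_sup A by split; [exists a|exists b => x [/andP[]]].
pose s := sup A.
have as_ : a <= s by apply: sup_upper_bound.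
have sb : s <= b by apply: ge_sup => [|x [/andP[]]//]; exists a.
have [e e0 [Qright Qleft]] := Qloc s (introT andP (conj as_ sb)).
have [x [/andP[ax xb] Qax] sx] := sup_adherent e0 supA.
have xs : x <= s by apply: sup_upper_bound => //; split=> //; apply/andP.
have Qas : Q a s.
  apply: Qtrans Qax _ => //; apply: Qleft => //.
  by rewrite sx.
move: sb; rewrite le_eqVlt => /predU1P[<-//|sb].
pose t := Num.min (s + e / 2) b.
have st : s < t by rewrite lt_min sb ltrDl divr_gt0.
have tb : t <= b by rewrite ge_min lexx orbT.
have Qat : Q a t.
  apply: Qtrans Qas _ => //; first exact: ltW.
  apply: Qright => //; rewrite ltW //=.
  by rewrite gt_min ltrD2l ltr_pdivrMr // ltr_pMr // ltr1n.
have : t <= s.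
  by apply: sup_upper_bound => //; split=> //; rewrite tb (le_trans as_) // ltW.
by rewrite leNgt st.
Qed.

(** * Limits and derivatives of matrices *)

Section MatrixLimits.
Context {R : realType}.

Lemma cvg_mxP (T : Type) (F : set_system T) (FF : Filter F) m n
    (M : T -> 'M[R]_(m, n)) (L : 'M[R]_(m, n)) :
  M t @[t --> F] --> L <-> (forall i j, M t i j @[t --> F] --> L i j).
Proof.
split=> [ML i j|ML].
  have h := continuous_cvg _ (@coord_continuous _ _ _ i j L) ML; exact: h.
apply/cvgrPdist_le => /= e e0.
suff : \forall t \near F, forall ij : 'I_m * 'I_n, `|L ij.1 ij.2 - M t ij.1 ij.2| <= e.
  apply: filterS => t ht.
  rewrite /Num.Def.normr/= mx_normrE (bigmax_le _ (ltW e0))//= => i _.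
  by rewrite !mxE.
apply: filter_forall => /= ij.
exact: ((cvgrPdist_le _ _).1 (ML ij.1 ij.2)).
Qed.

Lemma cvg_mulmx (T : Type) (F : set_system T) (FF : Filter F) m n p
    (M : T -> 'M[R]_(m, n)) (N : T -> 'M[R]_(n, p))
    (L : 'M[R]_(m, n)) (K : 'M[R]_(n, p)) :
  M t @[t --> F] --> L -> N t @[t --> F] --> K ->
  (M t *m N t) @[t --> F] --> L *m K.
Proof.
move=> /cvg_mxP ML /cvg_mxP NK; apply/cvg_mxP => i j.
rewrite mxE; under eq_cvg do rewrite mxE.
apply: cvg_big => [|k _]; first exact: add_continuous.
 apply: cvgM; [exact: ML|exact: NK].
Qed.

Lemma cvg_trmx (T : Type) (F : set_system T) (FF : Filter F) m n
    (M : T -> 'M[R]_(m, n)) (L : 'M[R]_(m, n)) :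
  M t @[t --> F] --> L -> (M t)^T @[t --> F] --> L^T.
Proof.
move=> /cvg_mxP ML; apply/cvg_mxP => i j.
by rewrite mxE; under eq_cvg do rewrite mxE; exact: ML.
Qed.

Lemma cvg_det (T : Type) (F : set_system T) (FF : Filter F) n
    (M : T -> 'M[R]_n) (L : 'M[R]_n) :
  M t @[t --> F] --> L -> \det (M t) @[t --> F] --> \det L.
Proof.
move=> /cvg_mxP ML; rewrite /determinant.
apply: cvg_big => [|s _]; first exact: add_continuous.
apply: cvgM; first exact: cvg_cst.
apply: cvg_big => [|i _]; first exact: mul_continuous.
exact: ML.
Qed.

Lemma is_derive_mxP (x : R) m n (M : R -> 'M[R]_(m, n)) (M' : 'M[R]_(m, n)) :
  is_derive x 1 M M' <-> (forall i j, is_derive x 1 (fun t => M t i j) (M' i j)).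
Proof.
split=> [[dM <-] i j|dM].
  rewrite derive_mx // mxE; apply: derivableP.
  by move/derivable_mxP : dM; apply.
have dM' : derivable M x 1 by apply/derivable_mxP => i j; have [] := dM i j.
apply: DeriveDef => //; rewrite derive_mx //; apply/matrixP => i j.
by rewrite mxE; have [_ ->] := dM i j.
Qed.

End MatrixLimits.

Section C01.
Context {R : realType}.

(** The form in which the differential equations are given on [0, 1]: continuity up to
the end points, where no derivative is required. *)
Definition primitive01 (W : normedModType R) (f f' : R -> W) : Prop :=
  {within `[(0 : R), 1], continuous f} /\
  (forall x, x \in `](0 : R), 1[ -> is_derive x 1 f (f' x)).

Lemma within_mxP m n (M : R -> 'M[R]_(m, n)) (A : set R) :
  {within A, continuous M} <->
  (forall i j, {within A, continuous (fun x => M x i j)}).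
Proof.
split=> [cM i j x|cM x]; first by have /cvg_mxP := cM x; apply.
by apply/cvg_mxP => i j; exact: cM.
Qed.

Lemma within_mulmx m n p (M : R -> 'M[R]_(m, n)) (N : R -> 'M[R]_(n, p)) (A : set R) :
  {within A, continuous M} -> {within A, continuous N} ->
  {within A, continuous (fun x => M x *m N x)}.
Proof. by move=> cM cN x; apply: cvg_mulmx; [exact: cM|exact: cN]. Qed.

Lemma primitive01_mxP m n (M M' : R -> 'M[R]_(m, n)) :
  primitive01 M M' <->
  (forall i j, primitive01 (fun x => M x i j) (fun x => M' x i j)).
Proof.
split=> [[cM dM] i j|MM].
  split=> [|x x01]; first by move/within_mxP : cM; apply.
  by have /is_derive_mxP := dM x x01; apply.
split=> [|x x01]; first by apply/within_mxP => i j; have [] := MM i j.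
by apply/is_derive_mxP => i j; have [_] := MM i j; apply.
Qed.

Lemma primitive01D (W : normedModType R) (f f' g g' : R -> W) :
  primitive01 f f' -> primitive01 g g' ->
  primitive01 (fun x => f x + g x) (fun x => f' x + g' x).
Proof.
move=> [cf df] [cg dg]; split=> [x|x x01].
  by apply: continuousD; [exact: cf|exact: cg].
by apply: is_deriveD; [exact: df|exact: dg].
Qed.

Lemma primitive01N (W : normedModType R) (f f' : R -> W) :
  primitive01 f f' -> primitive01 (fun x => - f x) (fun x => - f' x).
Proof.
move=> [cf df]; split=> [x|x x01]; first by apply: continuousN; exact: cf.
by apply: is_deriveN; exact: df.
Qed.

Lemma primitive01B (W : normedModType R) (f f' g g' : R -> W) :
  primitive01 f f' -> primitive01 g g' ->
  primitive01 (fun x => f x - g x) (fun x => f' x - g' x).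
Proof. by move=> Hf Hg; apply: primitive01D => //; exact: primitive01N. Qed.

Lemma primitive01_cst (W : normedModType R) (w : W) :
  primitive01 (fun=> w) (fun=> 0).
Proof. by split=> [|x _]; [exact: cst_continuous|exact: is_derive_cst]. Qed.

Lemma primitive01_id : primitive01 (@id R) (fun=> 1).
Proof.
split=> [x|x _]; last exact: is_derive_id.
by apply: continuous_subspaceT => ?; exact: cvg_id.
Qed.

Lemma primitive01M (f f' g g' : R -> R) :
  primitive01 f f' -> primitive01 g g' ->
  primitive01 (fun x => f x * g x) (fun x => f' x * g x + f x * g' x).
Proof.
move=> [cf df] [cg dg]; split=> [x|x x01].
  by apply: continuousM; [exact: cf|exact: cg].
have dfx := df x x01; have dgx := dg x x01.
have := is_deriveM dfx dgx => h; apply: is_derive_eq h _.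
by rewrite /GRing.scale /= addrC; congr (_ + _); rewrite mulrC.
Qed.

Lemma primitive01_sum (I : Type) (r : seq I) (f f' : I -> R -> R) :
  (forall i, primitive01 (f i) (f' i)) ->
  primitive01 (fun x => \sum_(i <- r) f i x) (fun x => \sum_(i <- r) f' i x).
Proof.
move=> ff; elim: r => [|i r IH].
  under eq_fun do rewrite big_nil; under [X in primitive01 _ X]eq_fun do rewrite big_nil.
  exact: primitive01_cst.
under eq_fun do rewrite big_cons; under [X in primitive01 _ X]eq_fun do rewrite big_cons.
exact: primitive01D.
Qed.

Lemma primitive01_mulmx m n p (A A' : R -> 'M[R]_(m, n)) (B B' : R -> 'M[R]_(n, p)) :
  primitive01 A A' -> primitive01 B B' ->
  primitive01 (fun x => A x *m B x) (fun x => A' x *m B x + A x *m B' x).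
Proof.
move=> /primitive01_mxP AA /primitive01_mxP BB; apply/primitive01_mxP => i j.
under eq_fun do rewrite mxE.
under [X in primitive01 _ X]eq_fun do rewrite !mxE -big_split /=.
by apply: primitive01_sum => k; apply: primitive01M.
Qed.

Lemma primitive01_trmx m n (A A' : R -> 'M[R]_(m, n)) :
  primitive01 A A' -> primitive01 (fun x => (A x)^T) (fun x => (A' x)^T).
Proof.
move=> /primitive01_mxP AA; apply/primitive01_mxP => i j.
under eq_fun do rewrite mxE; under [X in primitive01 _ X]eq_fun do rewrite mxE.
exact: AA.
Qed.

Lemma primitive01_ext (W : normedModType R) (f f' g' : R -> W) :
  (forall x, x \in `](0 : R), 1[ -> f' x = g' x) ->
  primitive01 f f' -> primitive01 f g'.
Proof. by move=> fg [cf df]; split=> // x x01; rewrite -fg //; exact: df. Qed.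

Lemma primitive01_ndecr (f f' : R -> R) : primitive01 f f' ->
  (forall x, x \in `](0 : R), 1[ -> 0 <= f' x) ->
  forall x y, 0 <= x -> x <= y -> y <= 1 -> f x <= f y.
Proof.
move=> [cf df] f'0 x y x0 xy y1.
have sub u : u \in `]x, y[ -> u \in `](0 : R), 1[.
  rewrite !in_itv /= => /andP[xu uy].
  by rewrite (le_lt_trans x0 xu) (lt_le_trans uy y1).
move: xy; rewrite le_eqVlt => /predU1P[->//|xy].
have [|c cxy fxy] := MVT xy (fun u hu => df u (sub u hu)).
  apply: continuous_subspaceW cf => u /=; rewrite !in_itv /= => /andP[xu uy].
  by rewrite (le_trans x0 xu) (le_trans uy y1).
by rewrite -subr_ge0 fxy mulr_ge0 ?subr_ge0 ?(ltW xy) ?f'0 ?sub.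
Qed.

Lemma primitive01_eq0 (f f' : R -> R) : primitive01 f f' ->
  (forall x, x \in `](0 : R), 1[ -> f' x = 0) ->
  forall x, x \in `[(0 : R), 1] -> f x = f 0.
Proof.
move=> F f'0 x; rewrite in_itv /= => /andP[x0 x1].
apply/le_anti/andP; split; last first.
  by apply: primitive01_ndecr F _ _ _ (lexx 0) x0 x1 => u u01; rewrite f'0.
rewrite -lerN2.
by apply: primitive01_ndecr (primitive01N F) _ _ _ (lexx 0) x0 x1 => u u01; rewrite f'0 ?oppr0.
Qed.

(** Used to pass from the vanishing of a function to that of its derivative. *)
Lemma primitive01_constant (W : normedModType R) (f f' : R -> W) (c : W) :
  primitive01 f f' -> (forall x, x \in `](0 : R), 1[ -> f x = c) ->
  forall x, x \in `](0 : R), 1[ -> f' x = 0.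
Proof.
move=> [_ df] fc x x01; have [_ <-] := df x x01.
have nf : \near x, c = f x by near=> t; rewrite fc //; near: t; exact: near_in_itvoo.
by have [_ ->] := near_eq_is_derive nf (is_derive_cst c x 1).
Unshelve. all: by end_near. Qed.

Lemma within01_bounded m n (M : R -> 'M[R]_(m, n)) :
  {within `[(0 : R), 1], continuous M} ->
  exists2 K : R, 0 <= K & forall x i j, x \in `[(0 : R), 1] -> `|M x i j| <= K.
Proof.
move=> cM; have [|c _ cmax] := @EVT_max R (fun x => `|M x|) 0 1 ler01.
  by move=> x; apply: (continuous_comp (cM x)); exact: norm_continuous.
exists `|M c| => // x i j x01; apply: le_trans (cmax x x01).
rewrite [leRHS]/Num.Def.normr/= mx_normrE.
exact: (le_bigmax _ (fun ij : 'I_m * 'I_n => `|M x ij.1 ij.2|) (i, j)).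
Qed.

(** Each entry has derivative 0 inside, hence is constant up to the end points. *)
Lemma within01_eq0 m n (M : R -> 'M[R]_(m, n)) :
  {within `[(0 : R), 1], continuous M} ->
  (forall x, x \in `](0 : R), 1[ -> M x = 0) ->
  forall x, x \in `[(0 : R), 1] -> M x = 0.
Proof.
move=> /within_mxP cM M0 x x01; apply/matrixP => i j; rewrite mxE.
have F : primitive01 (fun x => M x i j) (fun=> 0).
  split=> [|y y01]; first exact: cM.
  apply: near_eq_is_derive (is_derive_cst (0 : R) y 1).
  near=> z; rewrite M0 ?mxE //; near: z.
  by apply: near_in_itvoo.
have F0 := primitive01_eq0 F (fun x _ => erefl).
have half : (2^-1 : R) \in `](0 : R), 1[.
  by rewrite in_itv /= invr_gt0 ltr0n /= invf_lt1 ?ltr1n.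
have half' : (2^-1 : R) \in `[(0 : R), 1].
  by move: half; rewrite !in_itv /= => /andP[/ltW-> /ltW->].
by rewrite F0 // -(F0 _ half') M0 // mxE.
Unshelve. all: by end_near. Qed.

Lemma primitive01_integral (f : R -> R) : {within `[(0 : R), 1], continuous f} ->
  primitive01 (fun x => \int[lebesgue_measure]_(t in `[(0 : R), x]) f t) f.
Proof.
move=> cf.
have intf : lebesgue_measure.-integrable `[(0 : R), 1] (EFin \o f).
  by apply: continuous_compact_integrable => //; exact: segment_compact.
split=> [|x].
  exact: (parameterized_integral_continuous ler01 intf).
rewrite in_itv /= => /andP[x0 x1].
have cfx : {for x, continuous f}.
  by apply: (within_continuous_continuous ltr01 cf); rewrite in_itv /= x0.
have [dF Fx] := continuous_FTC1_closed x1 intf x0 cfx.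
by apply: DeriveDef; [exact: dF|rewrite -derive1E].
Qed.

End C01.

(** * Energy estimates *)

Section Energy.
Context {R : realType} {n : nat}.
Implicit Types y z : 'cV[R]_n.

Definition sqnorm y : R := (y^T *m y) 0 0.

Lemma sqnormE y : sqnorm y = \sum_i y i 0 ^+ 2.
Proof. by rewrite /sqnorm mxE; apply: eq_bigr => i _; rewrite mxE. Qed.

Lemma sqnorm_ge0 y : 0 <= sqnorm y.
Proof. by rewrite sqnormE; apply: sumr_ge0 => i _; rewrite sqr_ge0. Qed.

Lemma sqnorm_eq0 y : sqnorm y = 0 -> y = 0.
Proof.
rewrite sqnormE => /eqP; rewrite psumr_eq0; last by move=> i _; rewrite sqr_ge0.
move=> /allP y0; apply/colP => i; rewrite mxE; apply/eqP.
by have := y0 i (mem_index_enum i); rewrite /= sqrf_eq0.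
Qed.

Lemma sqr_le_sqnorm y i : y i 0 ^+ 2 <= sqnorm y.
Proof.
rewrite sqnormE (bigD1 i) //= lerDl.
by apply: sumr_ge0 => j _; rewrite sqr_ge0.
Qed.

Lemma bilinear_bound (A : 'M[R]_n) (K : R) y z :
  (forall i j, `|A i j| <= K) ->
  `|(y^T *m A *m z) 0 0| <= K * n%:R * (sqnorm y + sqnorm z).
Proof.
move=> AK.
have -> : (y^T *m A *m z) 0 0 = \sum_i \sum_j y i 0 * A i j * z j 0.
  rewrite mxE; under eq_bigr do rewrite mxE big_distrl /=.
  rewrite exchange_big; apply: eq_bigr => i _; apply: eq_bigr => j _.
  by rewrite mxE.
apply: (@le_trans _ _ (\sum_(i < n) \sum_(j < n) K * (y i 0 ^+ 2 + z j 0 ^+ 2))).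
  apply: le_trans (ler_norm_sum _ _ _) _; apply: ler_sum => i _.
  apply: le_trans (ler_norm_sum _ _ _) _; apply: ler_sum => j _.
  rewrite !normrM mulrAC [_ * `|A i j|]mulrC.
  apply: ler_pM; rewrite ?mulr_ge0 //.
  rewrite -normrM ler_norml; apply/andP; split.
    have := sqr_ge0 (y i 0 + z j 0); have := sqr_ge0 (y i 0); have := sqr_ge0 (z j 0).
    by rewrite sqrrD; lra.
  have := sqr_ge0 (y i 0 - z j 0); have := sqr_ge0 (y i 0); have := sqr_ge0 (z j 0).
  by rewrite sqrrB; lra.
rewrite le_eqVlt; apply/orP; left; apply/eqP.
under eq_bigr do rewrite -big_distrr /= big_split /= sumr_const card_ord -sqnormE.
rewrite -big_distrr /= big_split /= sumr_const card_ord sumrMnl -sqnormE.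
by rewrite -(mulr_natr (sqnorm y)) -(mulr_natr (sqnorm z)); ring.
Qed.

Lemma primitive01_exp (C : R) :
  primitive01 (fun x => expR (C * x)) (fun x => C * expR (C * x)).
Proof.
split=> [|x _].
  apply: continuous_subspaceT => x; apply: (continuous_comp (f := fun x => C * x)).
    by apply: continuousM; [exact: cst_continuous|exact: cvg_id].
  exact: continuous_expR.
have d : is_derive x 1 (fun x : R => C * x) C.
  have := is_deriveZ C (is_derive_id x (1 : R)) => h.
  by apply: is_derive_eq h _; rewrite /GRing.scale /= mulr1.
have := is_derive1_comp (is_derive_expR (C * x)) d => h.
by apply: is_derive_eq h _; rewrite mulrC.
Qed.

Lemma primitive01_energy (y z w : R -> 'cV[R]_n) :
  primitive01 y z -> primitive01 z w ->
  primitive01 (fun x => sqnorm (y x) + sqnorm (z x))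
    (fun x => 2 * (((y x)^T *m z x) 0 0 + ((z x)^T *m w x) 0 0)).
Proof.
move=> yz zw.
have D (u v : R -> 'cV[R]_n) : primitive01 u v ->
    primitive01 (fun x => sqnorm (u x)) (fun x => 2 * ((u x)^T *m v x) 0 0).
  move=> uv; have := primitive01_mulmx (primitive01_trmx uv) uv.
  move=> /primitive01_mxP/(_ 0 0); apply: primitive01_ext => x _.
  rewrite mxE -[(v x)^T *m _]trmxK trmx_mul trmxK [X in X + _]mxE; ring.
have := primitive01D (D _ _ yz) (D _ _ zw); apply: primitive01_ext => x _.
by rewrite mulrDr.
Qed.

(** A bound on the derivative of |y|^2 + |z|^2 along y' = z, z' = A y + g. *)
Lemma energy_rate (A : 'M[R]_n) (K B : R) (y z g : 'cV[R]_n) :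
  (forall i j, `|A i j| <= K) -> sqnorm g <= B ->
  `|2 * ((y^T *m z) 0 0 + (z^T *m (A *m y + g)) 0 0)| <=
    (2 + 2 * K * n%:R) * (sqnorm y + sqnorm z) + B.
Proof.
move=> AK gB.
have add (M N : 'M[R]_1) : (M + N) 0 0 = M 0 0 + N 0 0 by rewrite mxE.
have two_sum (a b : 'cV[R]_n) : `|2 * (a^T *m b) 0 0| <= sqnorm a + sqnorm b.
  rewrite /sqnorm.
  have e1 : 0 <= ((a + b)^T *m (a + b)) 0 0 by exact: sqnorm_ge0.
  have e2 : 0 <= ((a - b)^T *m (a - b)) 0 0 by exact: sqnorm_ge0.
  have ba : (b^T *m a) 0 0 = (a^T *m b) 0 0.
    by rewrite -[b^T *m a]trmxK trmx_mul trmxK mxE.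
  have opp (M : 'M[R]_1) : (- M) 0 0 = - M 0 0 by rewrite mxE.
  have aD : (a + b)^T = a^T + b^T by rewrite linearD.
  have aB : (a - b)^T = a^T - b^T by rewrite linearB.
  rewrite ler_norml; apply/andP; split.
    by move: e1; rewrite aD mulmxDl !mulmxDr !add ba; lra.
  by move: e2; rewrite aB mulmxBl !mulmxBr !(add, opp) ba; lra.
have h1 := two_sum y z; have h2 := two_sum z g.
have h3 := bilinear_bound z y AK.
have -> : 2 * ((y^T *m z) 0 0 + (z^T *m (A *m y + g)) 0 0) =
   2 * (y^T *m z) 0 0 + 2 * (z^T *m A *m y) 0 0 + 2 * (z^T *m g) 0 0.
  by rewrite mulmxDr mulmxA add; ring.
apply: le_trans (ler_normD _ _) _; apply: (le_trans (lerD (ler_normD _ _) (lexx _))).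
rewrite [`|2 * (_ *m A *m _) 0 0|]normrM ger0_norm //.
have := sqnorm_ge0 y.
move: (sqnorm y) (sqnorm z) (sqnorm g) gB h1 h2 h3 => sy sz sg gB h1 h2 h3 sy0.
set p := `|(_ *m A *m _) 0 0| in h3 *; set a := `|_| in h1 *; set b := `|_| in h2 *.
have -> : (2 + 2 * K * n%:R) * (sy + sz) = 2 * (sy + sz) + 2 * (K * n%:R * (sz + sy)) by ring.
lra.
Qed.

(** By [energy_rate], B x - exp (- C x) (|y|^2 + |z|^2) is nondecreasing for
C = 2 + 2 K n. *)
Lemma gronwall (A : R -> 'M[R]_n) (K B : R) (y z g : R -> 'cV[R]_n) :
    0 <= K -> (forall x i j, x \in `](0 : R), 1[ -> `|A x i j| <= K) ->
    primitive01 y z -> primitive01 z (fun x => A x *m y x + g x) ->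
    (forall x, x \in `](0 : R), 1[ -> sqnorm (g x) <= B) -> 0 <= B ->
  forall x, x \in `[(0 : R), 1] -> sqnorm (y x) + sqnorm (z x) <=
    expR (2 + 2 * K * n%:R) * (sqnorm (y 0) + sqnorm (z 0) + B).
Proof.
move=> K0 AK yz zw gB B0 x; rewrite in_itv /= => /andP[x0 x1].
set C := 2 + _; have C0 : 0 <= C by rewrite addr_ge0 // mulr_ge0 ?ler0n // mulr_ge0.
have E' := primitive01_energy yz zw.
set E := (fun x => sqnorm (y x) + sqnorm (z x)) in E'.
have F' := primitive01B (primitive01M (primitive01_cst B) primitive01_id)
  (primitive01M (primitive01_exp (- C)) E').
have ndecr := primitive01_ndecr F'.
have := ndecr _ 0 x (lexx _) x0 x1.
rewrite /= !mulr0 expR0 mul1r sub0r => le0x.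
have : - E 0 <= B * x - expR (- C * x) * E x.
  apply: le0x => u u01.
  have u0 : 0 <= u by move: u01; rewrite in_itv /= => /andP[/ltW].
  have := energy_rate (y u) (z u) (fun i j => AK u i j u01) (gB u u01).
  rewrite -/C ler_norml -/(E u) => /andP[_ rate].
  rewrite mul0r add0r mulr1 subr_ge0 -mulrA mulrCA -mulrDr.
  have e0 : 0 < expR (- C * u) := expR_gt0 _.
  have e1 : expR (- C * u) <= 1 by rewrite expR_le1 mulNr oppr_le0 mulr_ge0.
  apply: (@le_trans _ _ (expR (- C * u) * B)); last by rewrite ler_piMl.
  by rewrite ler_pM2l //; lra.
have : B * x <= B by rewrite ler_piMr.
move=> Bx h; have {Bx h} : expR (- C * x) * E x <= E 0 + B by lra.
rewrite mulNr expRN mulrC ler_pdivrMr ?expR_gt0 // mulrC => /le_trans; apply.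
apply: ler_wpM2r; first by rewrite addr_ge0 // addr_ge0 // sqnorm_ge0.
by rewrite ler_expR ler_piMr.
Qed.

(** The other side of [energy_rate]: exp (C x) (|y|^2 + |z|^2) is nondecreasing, so
that it vanishes at 0 when it does at 1. *)
Lemma gronwall_backward (A : R -> 'M[R]_n) (K : R) (y z : R -> 'cV[R]_n) :
    0 <= K -> (forall x i j, x \in `](0 : R), 1[ -> `|A x i j| <= K) ->
    primitive01 y z -> primitive01 z (fun x => A x *m y x) ->
    y 1 = 0 -> z 1 = 0 -> y 0 = 0 /\ z 0 = 0.
Proof.
move=> K0 AK yz zw y1 z1.
set C := 2 + 2 * K * n%:R.
have E' := primitive01_energy yz zw.
set E := (fun x => sqnorm (y x) + sqnorm (z x)) in E'.
have F' := primitive01M (primitive01_exp C) E'.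
have := primitive01_ndecr F' _ (lexx _) ler01 (lexx _).
rewrite /= mulr0 expR0 mul1r mulr1 => le01.
have sq0 : sqnorm (0 : 'cV[R]_n) = 0 by rewrite /sqnorm mulmx0 mxE.
have : E 0 <= expR C * E 1.
  apply: le01 => u u01.
  have g0 : sqnorm (0 : 'cV[R]_n) <= 0 by rewrite sq0.
  have := energy_rate (y u) (z u) (fun i j => AK u i j u01) g0.
  rewrite -/C !addr0 ler_norml -/(E u) => /andP[rate _].
  rewrite -mulrA mulrCA -mulrDr.
  by rewrite mulr_ge0 ?expR_ge0 //; lra.
rewrite /E y1 z1 sq0 addr0 mulr0 => E0.
have := sqnorm_ge0 (y 0); have := sqnorm_ge0 (z 0) => z0 y0.
by split; apply: sqnorm_eq0; lra.
Qed.

End Energy.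

(** * Self-adjoint boundary conditions *)

Section BoundaryMatrix.
Context {R : realType} {n : nat}.
Variables c1 c2 : 'M[R]_n.
Hypothesis c_sym : c1 *m c2^T = c2 *m c1^T.
Hypothesis c_norm : c1 *m c1^T + c2 *m c2^T = 1%:M.

(** In complex terms, the matrix c2^T - i c1^T is unitary. *)
Lemma boundary_orthogonal :
  block_mx c2^T c1^T (- c1^T) c2^T *m block_mx c2 (- c1) c1 c2 = 1%:M.
Proof.
apply: mulmx1C; rewrite mulmx_block !mulmxN !mulNmx opprK c_sym subrr.
by rewrite [_ + c1 *m c1^T]addrC c_norm scalar_mx_block.
Qed.

(** The boundary condition confines (y, z) to the Lagrangian subspace with frame
(c2^T, - c1^T). *)
Lemma boundary_param (y z : 'cV[R]_n) : c1 *m y + c2 *m z = 0 ->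
  y = c2^T *m (c2 *m y - c1 *m z) /\ z = - (c1^T *m (c2 *m y - c1 *m z)).
Proof.
move=> bc; have := congr1 (mulmx^~ (col_mx y z)) boundary_orthogonal.
rewrite mul1mx -mulmxA mul_block_col bc mulNmx mul_block_col !mulmx0 !addr0.
by rewrite mulNmx => /eq_col_mx[-> ->].
Qed.

Lemma boundary_dual :
  c2^T *m c1 = c1^T *m c2 /\ c1^T *m c1 + c2^T *m c2 = 1%:M.
Proof.
have := boundary_orthogonal.
rewrite mulmx_block scalar_mx_block => /eq_block_mx[c22 c21 _ _]; split.
  by apply/eqP; rewrite eq_sym -subr_eq0 -c21 mulmxN addrC.
by rewrite addrC.
Qed.

End BoundaryMatrix.

(** * Dependence of the frames on the spectral parameter *)

Section Frames.
Context {R : realType} {n : nat}.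
Variables (V : R -> 'M[R]_n) (a1 a2 : 'M[R]_n).
Hypothesis V_cont : {within `[(0 : R), 1], continuous V}.
Hypothesis V_sym : forall x, x \in `[(0 : R), 1] -> (V x)^T = V x.
Hypothesis a_lag : a1 *m a2^T - a2 *m a1^T = 0.
Hypothesis a_norm : a1 *m a1^T + a2 *m a2^T = 1%:M.
Variables X Z : R -> R -> 'M[R]_n.
Hypothesis XZ_sol : forall lam : R,
  frame_solution V a1 a2 lam (fun x => X x lam) (fun x => Z x lam).

Lemma subset_oo_cc (x : R) : x \in `](0 : R), 1[ -> x \in `[(0 : R), 1].
Proof. by rewrite !in_itv /= => /andP[/ltW-> /ltW->]. Qed.

Lemma frame_primitive lam :
  primitive01 (X^~ lam) (Z^~ lam) /\
  primitive01 (Z^~ lam) (fun x => (V x - lam%:M) *m X x lam).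
Proof.
have [cX cZ dXZ _ _] := XZ_sol lam.
by split; split=> // x x01; have [] := dXZ x x01.
Qed.

Lemma frame0 lam : X 0 lam = a2^T /\ Z 0 lam = - a1^T.
Proof. by have [] := XZ_sol lam. Qed.

Lemma primitive01_mulmx_cst m k l (M M' : R -> 'M[R]_(m, k)) (u : 'M[R]_(k, l)) :
  primitive01 M M' -> primitive01 (fun x => M x *m u) (fun x => M' x *m u).
Proof.
move=> MM; have := primitive01_mulmx MM (primitive01_cst u).
by apply: primitive01_ext => x _; rewrite mulmx0 addr0.
Qed.

Lemma frame_mulmx lam (u : 'cV[R]_n) :
  primitive01 (fun x => X x lam *m u) (fun x => Z x lam *m u) /\
  primitive01 (fun x => Z x lam *m u) (fun x => (V x - lam%:M) *m (X x lam *m u)).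
Proof.
have [XZ ZX] := frame_primitive lam; split; first exact: primitive01_mulmx_cst XZ.
by apply: primitive01_ext (primitive01_mulmx_cst u ZX) => x _; rewrite mulmxA.
Qed.

Lemma potential_bounded : exists2 K : R, 0 <= K &
  forall lam x i j, x \in `](0 : R), 1[ -> `|(V x - lam%:M) i j| <= K + `|lam|.
Proof.
have [K K0 VK] := within01_bounded V_cont; exists K => // lam x i j x01.
rewrite !mxE; apply: le_trans (ler_normB _ _) _; apply: lerD.
  exact/VK/subset_oo_cc.
by case: eqP => _; rewrite ?mulr1n ?mulr0n ?normr0.
Qed.

Lemma initial_injective (u : 'cV[R]_n) : a2^T *m u = 0 -> a1^T *m u = 0 -> u = 0.
Proof.
move=> h2 h1; rewrite -[u]mul1mx -a_norm mulmxDl -!mulmxA h1 h2 !mulmx0.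
by rewrite addr0.
Qed.

(** The case g = 0, B = 0 of [gronwall]. *)
Lemma solution_unique lam (y z : R -> 'cV[R]_n) :
    primitive01 y z -> primitive01 z (fun x => (V x - lam%:M) *m y x) ->
    y 0 = 0 -> z 0 = 0 ->
  forall x, x \in `[(0 : R), 1] -> y x = 0 /\ z x = 0.
Proof.
move=> yz zy y0 z0 x x01; have [K K0 VK] := potential_bounded.
have zy' : primitive01 z (fun x => (V x - lam%:M) *m y x + 0).
  by apply: primitive01_ext zy => u _; rewrite addr0.
have sq0 : sqnorm (0 : 'cV[R]_n) = 0 by rewrite /sqnorm mulmx0 mxE.
have := @gronwall R n (fun x => V x - lam%:M) (K + `|lam|) 0 y z (fun=> 0).
move=> /(_ _ (VK lam) yz zy' _ _ x x01); rewrite y0 z0 !sq0 !addr0 mulr0 => h.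
have {}h : sqnorm (y x) + sqnorm (z x) <= 0.
  by apply: h => //; rewrite addr_ge0.
have := sqnorm_ge0 (y x); have := sqnorm_ge0 (z x) => hz hy.
by split; apply: sqnorm_eq0; lra.
Qed.

(** By [boundary_param] the initial values are those of the columns of the frame
combined by u, and [solution_unique] applies to the difference. *)
Lemma solution_frame lam (y z : R -> 'cV[R]_n) :
    primitive01 y z -> primitive01 z (fun x => (V x - lam%:M) *m y x) ->
    a1 *m y 0 + a2 *m z 0 = 0 ->
  exists u, forall x, x \in `[(0 : R), 1] ->
    y x = X x lam *m u /\ z x = Z x lam *m u.
Proof.
move=> yz zy bc; pose u := a2 *m y 0 - a1 *m z 0; exists u.
have [X0 Z0] := frame0 lam.
have aa : a1 *m a2^T = a2 *m a1^T by apply/eqP; rewrite -subr_eq0 a_lag.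
have [y0 z0] := boundary_param aa a_norm bc; rewrite -/u in y0 z0; clearbody u.
have [Xu Zu] := frame_mulmx lam u.
move=> x x01.
have Ydiff := primitive01B yz Xu; have Zdiff := primitive01B zy Zu.
have Zdiff' : primitive01 (fun x => z x - Z x lam *m u)
   (fun x => (V x - lam%:M) *m (y x - X x lam *m u)).
  by apply: primitive01_ext Zdiff => t _; rewrite mulmxBr.
have [||/eqP + /eqP] := solution_unique Ydiff Zdiff' _ _ x01.
- by rewrite X0 y0 subrr.
- by rewrite Z0 mulNmx z0 subrr.
by rewrite !subr_eq0 => /eqP -> /eqP ->.
Qed.

(** Uniqueness for the problem with data given at the end point 1. *)
Lemma frame_injective_end lam (u : 'cV[R]_n) :
  X 1 lam *m u = 0 -> Z 1 lam *m u = 0 -> u = 0.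
Proof.
move=> X1 Z1; have [K K0 VK] := potential_bounded.
have [Xu Zu] := frame_mulmx lam u; have [X0 Z0] := frame0 lam.
have [|] := gronwall_backward _ (VK lam) Xu Zu X1 Z1; first by rewrite addr_ge0.
rewrite X0 Z0 mulNmx => h2 /eqP; rewrite oppr_eq0 => /eqP h1.
exact: initial_injective.
Qed.

(** If X u vanishes then so does its derivative Z u, hence both initial values. *)
Lemma frame_injective lam (u : 'cV[R]_n) :
  (forall x, x \in `](0 : R), 1[ -> X x lam *m u = 0) -> u = 0.
Proof.
move=> Xu0; have [Xu Zu] := frame_mulmx lam u; have [X0 Z0] := frame0 lam.
have zero01 : (0 : R) \in `[(0 : R), 1] by rewrite in_itv /= lexx ler01.
have X0u : X 0 lam *m u = 0.
  by apply: (within01_eq0 (M := fun x => X x lam *m u)) => //; case: Xu.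
have Z0u : Z 0 lam *m u = 0.
  apply: (within01_eq0 (M := fun x => Z x lam *m u)) => //; first by case: Zu.
  exact: primitive01_constant Xu Xu0.
move: Z0u X0u; rewrite X0 Z0 mulNmx => /eqP; rewrite oppr_eq0 => /eqP h1 h2.
exact: initial_injective.
Qed.

(** The difference of the frames for mu and lam solves the equation for mu with the
forcing term (lam - mu) X_lam and initial value 0. The constant 1 + c bounds sqrt c. *)
Lemma frame_lipschitz lam : exists2 C : R, 0 <= C &
  forall mu x i j, `|mu - lam| <= 1 -> x \in `[(0 : R), 1] ->
    `|X x mu i j - X x lam i j| <= C * `|mu - lam| /\
    `|Z x mu i j - Z x lam i j| <= C * `|mu - lam|.
Proof.
have [K K0 VK] := potential_bounded.
have [KX KX0 XK] := within01_bounded (proj1 (proj1 (frame_primitive lam))).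
pose c := expR (2 + 2 * (K + (`|lam| + 1)) * n%:R) * (n%:R * KX ^+ 2).
have c0 : 0 <= c by rewrite mulr_ge0 ?expR_ge0 // mulr_ge0 ?ler0n ?sqr_ge0.
exists (1 + c) => [|mu x i j mulam x01]; first by rewrite addr_ge0.
pose u : 'cV[R]_n := delta_mx j 0.
have colE (M : 'M[R]_n) k : (M *m u) k 0 = M k j by rewrite -colE mxE.
have [Xm Zm] := frame_mulmx mu u; have [Xl Zl] := frame_mulmx lam u.
have Y := primitive01B Xm Xl; have W := primitive01B Zm Zl.
pose g x := (lam - mu) *: (X x lam *m u).
have W' : primitive01 (fun x => Z x mu *m u - Z x lam *m u)
    (fun x => (V x - mu%:M) *m (X x mu *m u - X x lam *m u) + g x).
  apply: primitive01_ext W => t _; rewrite /g mulmxBr !mulmxBl !mul_scalar_mx.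
  move: (X t mu *m u) (X t lam *m u) => p q.
  by move: (V t *m p) (V t *m q) => Vp Vq; apply/colP => k; rewrite !mxE; ring.
have gB t : t \in `](0 : R), 1[ -> sqnorm (g t) <= (mu - lam) ^+ 2 * (n%:R * KX ^+ 2).
  move=> t01; rewrite sqnormE.
  apply: (@le_trans _ _ (\sum_(i < n) (mu - lam) ^+ 2 * KX ^+ 2)).
    apply: ler_sum => k _; rewrite mxE colE exprMn -sqrrN opprB.
    apply: ler_wpM2l; first exact: sqr_ge0.
    rewrite -[X in X <= _]real_normK ?num_real //.
    by rewrite ler_sqr ?nnegrE // XK // subset_oo_cc.
  by rewrite sumr_const card_ord -[leLHS]mulr_natr -mulrA [_ * n%:R]mulrC.
have Vmu t k l : t \in `](0 : R), 1[ -> `|(V t - mu%:M) k l| <= K + (`|lam| + 1).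
  move=> t01; apply: le_trans (VK _ _ _ _ t01) _; rewrite lerD2l.
  by rewrite -[mu](subrK lam) addrC; apply: le_trans (ler_normD _ _) _; rewrite lerD2l.
have KK : 0 <= K + (`|lam| + 1) by rewrite !addr_ge0.
have B0 : 0 <= (mu - lam) ^+ 2 * (n%:R * KX ^+ 2).
  by rewrite mulr_ge0 ?sqr_ge0 // mulr_ge0 ?ler0n ?sqr_ge0.
have := gronwall KK Vmu Y W' gB B0 x01.
have [-> ->] := frame0 mu; have [-> ->] := frame0 lam.
have sq0 : sqnorm (0 : 'cV[R]_n) = 0 by rewrite /sqnorm mulmx0 mxE.
rewrite !subrr !sq0 !add0r mulrCA -/c => bound.
have small (v : 'cV[R]_n) : sqnorm v <= (mu - lam) ^+ 2 * c ->
    `|v i 0| <= (1 + c) * `|mu - lam|.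
  move=> vc; rewrite -ler_sqr ?nnegrE ?mulr_ge0 ?addr_ge0 //.
  rewrite exprMn !real_normK ?num_real //.
  apply: le_trans (sqr_le_sqnorm v i) _; apply: (le_trans vc); rewrite mulrC.
  apply: ler_wpM2r; first exact: sqr_ge0.
  by rewrite sqrrD expr1n; have := sqr_ge0 c; lra.
have sub (v w : 'cV[R]_n) : (v - w) i 0 = v i 0 - w i 0 by rewrite !mxE.
have sX := sqnorm_ge0 (X x mu *m u - X x lam *m u).
have sZ := sqnorm_ge0 (Z x mu *m u - Z x lam *m u).
split.
  by have := small (X x mu *m u - X x lam *m u); rewrite sub !colE; apply; lra.
by have := small (Z x mu *m u - Z x lam *m u); rewrite sub !colE; apply; lra.
Qed.

(** The symplectic pairing of the columns of two frames. *)
Definition wronskian x mu lam : 'M[R]_n :=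
  (X x mu)^T *m Z x lam - (Z x mu)^T *m X x lam.

Lemma wronskian0 mu lam : wronskian 0 mu lam = 0.
Proof.
rewrite /wronskian; have [-> ->] := frame0 mu; have [-> ->] := frame0 lam.
rewrite trmxK mulmxN; have -> : (- a1^T)^T = - a1 by rewrite linearN /= trmxK.
by rewrite mulNmx opprK addrC; apply/eqP; rewrite -subr_eq0 subr0 a_lag.
Qed.

(** The potential cancels because V is symmetric. *)
Lemma wronskian_primitive mu lam :
  primitive01 (fun x => wronskian x mu lam)
    (fun x => (mu - lam) *: ((X x mu)^T *m X x lam)).
Proof.
have [Xm Zm] := frame_primitive mu; have [Xl Zl] := frame_primitive lam.
have := primitive01B (primitive01_mulmx (primitive01_trmx Xm) Zl)
                     (primitive01_mulmx (primitive01_trmx Zm) Xl).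
apply: primitive01_ext => x x01.
rewrite trmx_mul; have -> : (V x - mu%:M)^T = V x - mu%:M.
  by rewrite linearB /= tr_scalar_mx V_sym // subset_oo_cc.
rewrite !mulmxBl !mulmxBr !mulmxBl !mul_scalar_mx -!scalemxAr mul_mx_scalar -scalemxAl !mulmxA.
move: (_ *m V x *m _) ((Z x mu)^T *m _) ((X x mu)^T *m X x lam) => M N P.
by apply/matrixP => i j; rewrite !mxE; ring.
Qed.

Lemma frame_symmetric lam : (X 1 lam)^T *m Z 1 lam = (Z 1 lam)^T *m X 1 lam.
Proof.
apply/eqP; rewrite -subr_eq0; apply/eqP/matrixP => i j.
have W0 := wronskian0 lam lam.
have /primitive01_mxP/(_ i j) W := wronskian_primitive lam lam.
have one01 : (1 : R) \in `[(0 : R), 1] by rewrite in_itv /= lexx ler01.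
have W' x : x \in `](0 : R), 1[ ->
    ((lam - lam) *: ((X x lam)^T *m X x lam)) i j = 0.
  by move=> _; rewrite subrr scale0r mxE.
have := primitive01_eq0 W W' one01.
by rewrite W0 -/(wronskian 1 lam lam) => ->; rewrite !mxE.
Qed.

(** The Gram matrix of the columns of the frame in L^2(0, x). *)
Definition gram x lam : 'M[R]_n := \matrix_(i, j)
  \int[lebesgue_measure]_(t in `[(0 : R), x]) ((X t lam)^T *m X t lam) i j.

Lemma gram_primitive lam :
  primitive01 (gram^~ lam) (fun x => (X x lam)^T *m X x lam) /\ gram 0 lam = 0.
Proof.
split; last first.
  by apply/matrixP => i j; rewrite !mxE set_itv1 Rintegral_set1.
have [[cX _] _] := frame_primitive lam.
have cXX : {within `[(0 : R), 1], continuous (fun x => (X x lam)^T *m X x lam)}.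
  by move=> x; apply: cvg_mulmx; [apply: cvg_trmx|]; exact: cX.
apply/primitive01_mxP => i j; under eq_fun do rewrite mxE.
by apply: primitive01_integral; move/within_mxP : cXX; apply.
Qed.

(** The quadratic form of u is the integral of |X u|^2; if it vanishes then X u does,
and so does u. *)
Lemma gram_posdef lam : posdef (gram 1 lam).
Proof.
move=> u u0; have [G G0] := gram_primitive lam.
have : primitive01 (fun x => (u *m gram x lam *m u^T) 0 0)
    (fun x => sqnorm (X x lam *m u^T)).
  have := primitive01_mulmx_cst u^T (primitive01_mulmx (primitive01_cst u) G).
  move=> /primitive01_mxP/(_ 0 0); apply: primitive01_ext => x _.
  by rewrite mul0mx add0r /sqnorm trmx_mul trmxK !mulmxA.
move=> Q; have Qge0 x : x \in `](0 : R), 1[ -> 0 <= sqnorm (X x lam *m u^T).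
  by move=> _; exact: sqnorm_ge0.
have ndecr := primitive01_ndecr Q Qge0.
rewrite /qform lt_neqAle; apply/andP; split; last first.
  by have := ndecr _ _ (lexx 0) ler01 (lexx 1); rewrite G0 mulmx0 mul0mx mxE.
apply: contra_neq u0 => Q1.
suff : u^T = 0 by move=> /(congr1 trmx); rewrite trmxK trmx0.
apply: (@frame_injective lam) => x x01; apply: sqnorm_eq0; move: x x01.
apply: (primitive01_constant (c := 0) Q) => x; rewrite in_itv /= => /andP[/ltW x0 /ltW x1].
have := ndecr _ _ (lexx 0) x0 x1; have := ndecr _ _ x0 x1 (lexx 1).
have Q0 : (u *m gram 0 lam *m u^T) 0 0 = 0 by rewrite G0 mulmx0 mul0mx mxE.
by rewrite -Q1 Q0 => h1 h2; apply/le_anti/andP; split; [exact: h1|exact: h2].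
Qed.

(** The derivatives of both sides in x differ by (mu - lam) (X_mu - X_lam)^T X_lam,
which is quadratic in mu - lam by [frame_lipschitz]. *)
Lemma wronskian_gram lam : exists2 C : R, 0 <= C &
  forall mu i j, `|mu - lam| <= 1 ->
    `|wronskian 1 mu lam i j - (mu - lam) * gram 1 lam i j| <= C * `|mu - lam| ^+ 2.
Proof.
have [C C0 XC] := frame_lipschitz lam.
have [[cX _] _] := frame_primitive lam; have [KX KX0 XK] := within01_bounded cX.
exists (n%:R * (C * KX)) => [|mu i j mulam]; first by rewrite !mulr_ge0 ?ler0n.
have [/primitive01_mxP/(_ i j) G G0] := gram_primitive lam.
have /primitive01_mxP/(_ i j) W := wronskian_primitive mu lam.
have D := primitive01B W (primitive01M (primitive01_cst (mu - lam)) G).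
set B := n%:R * (C * KX) * `|mu - lam| ^+ 2.
have rate x : x \in `](0 : R), 1[ ->
  `|((mu - lam) *: ((X x mu)^T *m X x lam)) i j -
    (0 * gram x lam i j + (mu - lam) * ((X x lam)^T *m X x lam) i j)| <= B.
  move=> x01.
  rewrite mul0r add0r.
  have -> : ((mu - lam) *: ((X x mu)^T *m X x lam)) i j -
      (mu - lam) * ((X x lam)^T *m X x lam) i j =
      (mu - lam) * \sum_k (X x mu k i - X x lam k i) * X x lam k j.
    rewrite !mxE -mulrBr -sumrB; congr (_ * _); apply: eq_bigr => k _.
    by rewrite !mxE mulrBl.
  have -> : B = `|mu - lam| * \sum_(k < n) C * `|mu - lam| * KX.
    by rewrite sumr_const card_ord -[X in _ * X]mulr_natr /B; ring.
  rewrite normrM; apply: ler_wpM2l => //.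
  apply: le_trans (ler_norm_sum _ _ _) _; apply: ler_sum => k _; rewrite normrM.
  by apply: ler_pM => //; [case: (XC mu x k i) => //|apply: XK]; exact: subset_oo_cc.
have B' := primitive01M (primitive01_cst B) primitive01_id.
have up := primitive01_ndecr (primitive01B B' D) _ (lexx 0) ler01 (lexx 1).
have lo := primitive01_ndecr (primitive01D B' D) _ (lexx 0) ler01 (lexx 1).
have {}up : B * 0 - (wronskian 0 mu lam i j - (mu - lam) * gram 0 lam i j) <=
    B * 1 - (wronskian 1 mu lam i j - (mu - lam) * gram 1 lam i j).
  apply: up => x x01; have := rate x x01; rewrite ler_norml => /andP[h1 h2].
  by rewrite mul0r mulr1 add0r subr_ge0.
have {}lo : B * 0 + (wronskian 0 mu lam i j - (mu - lam) * gram 0 lam i j) <=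
    B * 1 + (wronskian 1 mu lam i j - (mu - lam) * gram 1 lam i j).
  apply: lo => x x01; have := rate x x01; rewrite ler_norml => /andP[h1 h2].
  by rewrite mul0r mulr1 add0r; move: h1; lra.
have W00 : wronskian 0 mu lam i j = 0 by rewrite wronskian0 mxE.
have G00 : gram 0 lam i j = 0 by rewrite G0 mxE.
move: up lo; rewrite W00 G00 => up lo.
by rewrite ler_norml; apply/andP; split; lra.
Qed.

End Frames.

(** * Eigenfunctions of the operator *)

Section BoundaryValue.
Context {R : realType} {n : nat}.
Variables (V : R -> 'M[R]_n) (a1 a2 b1 b2 : 'M[R]_n).
Hypothesis V_cont : {within `[(0 : R), 1], continuous V}.
Hypothesis a_lag : a1 *m a2^T - a2 *m a1^T = 0.
Hypothesis b_lag : b1 *m b2^T - b2 *m b1^T = 0.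
Hypothesis a_norm : a1 *m a1^T + a2 *m a2^T = 1%:M.
Hypothesis b_norm : b1 *m b1^T + b2 *m b2^T = 1%:M.
Variables X Z : R -> R -> 'M[R]_n.
Hypothesis XZ_sol : forall lam : R,
  frame_solution V a1 a2 lam (fun x => X x lam) (fun x => Z x lam).

Definition boundary lam : 'M[R]_n := b1 *m X 1 lam + b2 *m Z 1 lam.

(** On the Lagrangian subspace with frame (c2^T, - c1^T), the product y . z is a
quadratic form in y alone: if c2 g c2 = c2 then c1^T g^T is its matrix up to sign. *)
Lemma boundary_form (c1 c2 : 'M[R]_n) : c1 *m c2^T = c2 *m c1^T ->
  exists2 C : R, 0 <= C & forall v : 'cV[R]_n,
    `|((c2^T *m v)^T *m (c1^T *m v)) 0 0| <= C * sqnorm (c2^T *m v).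
Proof.
move=> cc; pose A := c1^T *m (pinvmx c2)^T.
pose K := \sum_i \sum_j `|A i j|.
have K0 : 0 <= K by apply: sumr_ge0 => i _; apply: sumr_ge0.
have AK i j : `|A i j| <= K.
  rewrite /K (bigD1 i) //= (bigD1 j) //= -addrA lerDl.
  by rewrite addr_ge0 // ?sumr_ge0 // => k _; rewrite sumr_ge0.
exists (K * n%:R * 2) => [|v]; first by rewrite !mulr_ge0 ?ler0n.
have -> : (c2^T *m v)^T *m (c1^T *m v) = (c2^T *m v)^T *m A *m (c2^T *m v).
  have cA : c2 *m A *m c2^T = c2 *m c1^T.
    have gK : c2^T *m (pinvmx c2)^T *m c2^T = c2^T.
      by rewrite -!trmx_mul mulmxA mulmxKpV.
    by rewrite /A mulmxA -cc -!mulmxA (mulmxA c2^T) gK.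
  rewrite trmx_mul trmxK; apply/esym.
  transitivity (v^T *m (c2 *m A *m c2^T) *m v); first by rewrite !mulmxA.
  by rewrite cA !mulmxA.
by apply: le_trans (bilinear_bound _ _ AK) _; lra.
Qed.

(** For an eigenfunction y and z = y', consider f = y . z + C (1 - 2 x) |y|^2. By
[boundary_form], for C large enough, f(0) >= 0 >= f(1). On the other hand,
completing the square in z, f' >= |y|^2 as soon as - lam is at least
2 C + C^2 + 2 K n + 1, where K bounds the entries of V. Hence f vanishes identically, and so does y. *)
Lemma spectrum_bounded_below : exists2 L : R, 0 < L &
  forall lam v, lam <= - L -> boundary lam *m v = 0 -> v = 0 :> 'cV_n.
Proof.
have aa : a1 *m a2^T = a2 *m a1^T by apply/eqP; rewrite -subr_eq0 a_lag.
have bb : b1 *m b2^T = b2 *m b1^T by apply/eqP; rewrite -subr_eq0 b_lag.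
have [Ca Ca0 Ha] := boundary_form aa; have [Cb Cb0 Hb] := boundary_form bb.
have [K K0 VK] := within01_bounded V_cont.
pose C := Ca + Cb; have C0 : 0 <= C by rewrite addr_ge0.
pose L := 2 * C + C ^+ 2 + 2 * (K * n%:R) + 1.
have L0 : 0 < L.
  by rewrite ltr_wpDl // !addr_ge0 ?mulr_ge0 ?ler0n ?sqr_ge0.
exists L => // lam v lamL bv.
have [Xv Zv] := frame_mulmx XZ_sol lam v; have [X0 Z0] := frame0 XZ_sol lam.
set y := (fun x => X x lam *m v) in Xv Zv; set z := (fun x => Z x lam *m v) in Xv Zv.
pose dot (u w : 'cV[R]_n) : R := (u^T *m w) 0 0.
pose kappa (x : R) := C * (1 - 2 * x).
have kP : primitive01 kappa (fun=> - (2 * C)).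
  have := primitive01M (primitive01_cst C)
    (primitive01B (primitive01_cst (1 : R)) (primitive01M (primitive01_cst (2 : R)) primitive01_id)).
  by apply: primitive01_ext => x _ /=; ring.
have dotP (u u' w w' : R -> 'cV[R]_n) : primitive01 u u' -> primitive01 w w' ->
    primitive01 (fun x => dot (u x) (w x)) (fun x => dot (u' x) (w x) + dot (u x) (w' x)).
  move=> uu ww; have := primitive01_mulmx (primitive01_trmx uu) ww.
  by move=> /primitive01_mxP/(_ 0 0); apply: primitive01_ext => x _; rewrite mxE.
have F := primitive01D (dotP _ _ _ _ Xv Zv) (primitive01M kP (dotP _ _ _ _ Xv Xv)).
set f := (fun x => dot (y x) (z x) + kappa x * dot (y x) (y x)) in F.
have rate x : x \in `](0 : R), 1[ -> dot (y x) (y x) <=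
   dot (z x) (z x) + dot (y x) ((V x - lam%:M) *m y x) +
   (- (2 * C) * dot (y x) (y x) + kappa x * (dot (z x) (y x) + dot (y x) (z x))).
  move=> x01.
  have e1 : 0 <= dot (z x + kappa x *: y x) (z x + kappa x *: y x) by exact: sqnorm_ge0.
  have := bilinear_bound (y x) (y x) (fun i j => VK x i j (subset_oo_cc x01)).
  rewrite ler_norml => /andP[e2 _].
  have k2 : kappa x ^+ 2 <= C ^+ 2.
    move: x01; rewrite in_itv /= => /andP[x0 x1].
    rewrite /kappa exprMn ler_piMr ?sqr_ge0 //.
    have : 0 <= x * (1 - x) by rewrite mulr_ge0 ?subr_ge0 // ltW.
    by rewrite !expr2; lra.
  have : dot (z x + kappa x *: y x) (z x + kappa x *: y x) =
      dot (z x) (z x) + kappa x * (dot (z x) (y x) + dot (y x) (z x)) +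
      kappa x ^+ 2 * dot (y x) (y x).
    rewrite /dot; have -> : (z x + kappa x *: y x)^T = (z x)^T + kappa x *: (y x)^T.
      by apply/matrixP => i j; rewrite !mxE.
    rewrite mulmxDl !mulmxDr -!scalemxAl -!scalemxAr.
    have add (M N : 'M[R]_1) : (M + N) 0 0 = M 0 0 + N 0 0 by rewrite mxE.
    have scale c (M : 'M[R]_1) : (c *: M) 0 0 = c * M 0 0 by rewrite mxE.
    by rewrite !(add, scale); ring.
  have : dot (y x) ((V x - lam%:M) *m y x) =
      ((y x)^T *m V x *m y x) 0 0 - lam * dot (y x) (y x).
    rewrite /dot mulmxBl mulmxBr mul_scalar_mx -scalemxAr mulmxA.
    have sub (M N : 'M[R]_1) : (M - N) 0 0 = M 0 0 - N 0 0 by rewrite !mxE.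
    have scale c (M : 'M[R]_1) : (c *: M) 0 0 = c * M 0 0 by rewrite mxE.
    by rewrite sub scale.
  have yy0 : 0 <= dot (y x) (y x) by exact: sqnorm_ge0.
  have : 0 <= (- L - lam) * dot (y x) (y x) by rewrite mulr_ge0 // subr_ge0.
  have : 0 <= (C ^+ 2 - kappa x ^+ 2) * dot (y x) (y x) by rewrite mulr_ge0 // subr_ge0.
  move: e1 e2; rewrite -/(dot (y x) (y x)) /sqnorm -/(dot (y x) (y x)) /L.
  move: (dot (y x) (y x)) (dot (z x) (z x)) (dot (z x) (y x) + _) (dot _ _) (dot _ _) (_ 0 0) => s t p q r m.
  lra.
have opp (M : 'M[R]_1) : (- M) 0 0 = - M 0 0 by rewrite mxE.
have zero_lo : 0 <= f 0.
  have := Ha v; rewrite ler_norml => /andP[_ ha].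
  have -> : f 0 = - dot (a2^T *m v) (a1^T *m v) + C * sqnorm (a2^T *m v).
    by rewrite /f /kappa /y /z X0 Z0 /dot mulNmx mulmxN mulr0 subr0 mulr1 opp.
  have := mulr_ge0 Cb0 (sqnorm_ge0 (a2^T *m v)).
  by move: ha; rewrite -/(dot _ _) /C; lra.
have zero_hi : f 1 <= 0.
  have bc : b1 *m y 1 + b2 *m z 1 = 0 by rewrite /y /z !mulmxA -mulmxDl.
  have [y1 z1] := boundary_param bb b_norm bc.
  set w := _ - _ in y1 z1.
  have := Hb w; rewrite ler_norml => /andP[hb _].
  have -> : f 1 = - dot (b2^T *m w) (b1^T *m w) - C * sqnorm (b2^T *m w).
    rewrite /f /kappa z1 y1 /dot mulmxN mulr1 -/(sqnorm (b2^T *m w)).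
    by rewrite (_ : 1 - 2 = -1 :> R) ?mulrN1 ?mulNr ?opp //; lra.
  have := mulr_ge0 Ca0 (sqnorm_ge0 (b2^T *m w)).
  by move: hb; rewrite -/(dot _ _) /C; lra.
have fnd := primitive01_ndecr F (fun x x01 => le_trans (sqnorm_ge0 (y x)) (rate x x01)).
have f0 x : x \in `](0 : R), 1[ -> f x = 0.
  rewrite in_itv /= => /andP[/ltW x0 /ltW x1].
  have := fnd _ _ (lexx 0) x0 x1; have := fnd _ _ x0 x1 (lexx 1).
  by move=> h1 h2; apply/le_anti/andP; split; lra.
apply: (frame_injective a_norm XZ_sol (lam := lam)) => x x01.
apply: sqnorm_eq0; apply/le_anti; rewrite sqnorm_ge0 andbT.
by rewrite -(primitive01_constant F f0 x01); exact: rate.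
Qed.

Lemma continuous_L2_01 (w : R -> 'cV[R]_n) :
  {within `[(0 : R), 1], continuous w} -> L2_01 w.
Proof.
move=> /within_mxP cw i; have cwi := cw i 0; split.
  exact: subspace_continuous_measurable_fun.
apply: (continuous_compact_integrable (f := fun x => w x i 0 ^+ 2)).
  exact: segment_compact.
have -> : (fun x => w x i 0 ^+ 2) = (fun x => w x i 0 * w x i 0).
  by apply/funext => x; rewrite expr2.
by move=> x; apply: continuousM; exact: cwi.
Qed.

Lemma within_potential lam (y : R -> 'cV[R]_n) :
  {within `[(0 : R), 1], continuous y} ->
  {within `[(0 : R), 1], continuous (fun x => (V x - lam%:M) *m y x)}.
Proof.
move=> cy; apply: within_mulmx => // x.
by apply: cvgB; [exact: V_cont|exact: cvg_cst].
Qed.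

Lemma frame_eigenfunction lam (v : 'cV[R]_n) : boundary lam *m v = 0 ->
  eigenfunction (schrodinger V a1 a2 b1 b2) lam (fun x => X x lam *m v).
Proof.
move=> bv; have [[cX dX] [cZ dZ]] := frame_mulmx XZ_sol lam v.
have [X0 Z0] := frame0 XZ_sol lam.
have cW := within_potential (lam := lam) cX.
exists (fun x => Z x lam *m v), (fun x => (V x - lam%:M) *m (X x lam *m v)); split.
- split; [exact: cX|exact: cZ|exact: dX|exact: continuous_L2_01|].
  move=> x i x01.
  have /primitive01_mxP/(_ i 0) ZP : primitive01 (fun x => Z x lam *m v)
     (fun x => (V x - lam%:M) *m (X x lam *m v)) by [].
  have /(_ i 0) cWi := (within_mxP _ _).1 cW.
  have D := primitive01B ZP (primitive01_integral cWi).
  have := primitive01_eq0 D (fun t _ => subrr _) x01.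
  by rewrite set_itv1 Rintegral_set1 subr0 => <-; rewrite subrK.
- by rewrite X0 Z0 mulNmx mulmxN !mulmxA -mulmxBl a_lag mul0mx.
- by rewrite !mulmxA -mulmxDl.
- apply: aeW => x x01; rewrite mulmxBl mul_scalar_mx.
  by rewrite opprB subrK.
Qed.

(** The second weak derivative w equals the continuous function (V - lam) y almost
everywhere, so that z is a classical primitive of it. *)
Lemma eigenfunction_frame lam (y : R -> 'cV[R]_n) :
  eigenfunction (schrodinger V a1 a2 b1 b2) lam y ->
  exists v, boundary lam *m v = 0 /\
    forall x, x \in `[(0 : R), 1] -> y x = X x lam *m v.
Proof.
move=> [z [w [[cy cz dy L2w zw] bc0 bc1 Hy]]].
pose h x := (V x - lam%:M) *m y x.
have ch : {within `[(0 : R), 1], continuous h} by exact: within_potential.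
have zh x i : x \in `[(0 : R), 1] ->
    z x i 0 = z 0 i 0 + \int[lebesgue_measure]_(t in `[(0 : R), x]) h t i 0.
  move=> x01; rewrite zw //; congr (_ + fine _).
  have x1 : x <= 1 by move: x01; rewrite in_itv /= => /andP[].
  have sub : `[0, x] `<=` `[(0 : R), 1].
    by move=> t /=; rewrite !in_itv /= => /andP[-> /le_trans]; apply.
  have [mw _] := L2w i.
  apply: ae_eq_integral => //.
  - apply/measurable_EFinP; apply: measurable_funS mw => //.
  - apply/measurable_EFinP; apply: (@measurable_funS _ _ _ _ `[(0 : R), 1]) => //.
    by apply: subspace_continuous_measurable_fun => //; exact: ((within_mxP _ _).1 ch i 0).
  have FF : Filter (almost_everywhere (@lebesgue_measure R)) by exact: ae_filter_ringOfSetsType.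
  apply: (@filterS _ _ FF _ _ _ Hy) => t Ht t0x; congr EFin.
  have /matrixP/(_ i 0) : w t = h t.
    have := Ht (sub _ t0x); rewrite /h mulmxBl mul_scalar_mx => ->.
    by rewrite opprD opprK addrC subrK.
  by [].
have zP : primitive01 z h.
  split=> // x x01; apply/is_derive_mxP => i j; rewrite (ord1 j).
  have [_ /(_ x x01) H] := primitive01_integral ((within_mxP _ _).1 ch i 0).
  have H' := is_deriveD (is_derive_cst (z 0 i 0) x 1) H.
  rewrite add0r in H'; apply: near_eq_is_derive H'.
  near=> t; rewrite (zh t) //; apply: subset_oo_cc; near: t; exact: near_in_itvoo.
have [v yv] := solution_frame V_cont a_lag a_norm XZ_sol (conj cy dy) zP bc0.
exists v; split=> [|x x01]; last by have [] := yv x x01.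
have one01 : (1 : R) \in `[(0 : R), 1] by rewrite in_itv /= lexx ler01.
have [y1 z1] := yv _ one01.
by move: bc1; rewrite y1 z1 !mulmxA -mulmxDl.
Unshelve. all: by end_near. Qed.

Definition multiplicity lam : nat := (n - \rank (boundary lam))%N.

Lemma multiplicity_unit lam : boundary lam \in unitmx -> multiplicity lam = 0%N.
Proof. by move=> bu; rewrite /multiplicity mxrank_unit // subnn. Qed.

Lemma has_multiplicity_boundary lam :
  has_multiplicity (schrodinger V a1 a2 b1 b2) lam (multiplicity lam).
Proof.
pose B := row_base (kermx (boundary lam)^T).
have rB : \rank (kermx (boundary lam)^T) = multiplicity lam.
  by rewrite mxrank_ker mxrank_tr.
rewrite -rB; pose b i := (row i B)^T.
have bE (c : 'I_(\rank (kermx (boundary lam)^T)) -> R) :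
    \sum_i c i *: b i = ((\row_i c i) *m B)^T.
  rewrite mulmx_sum_row linear_sum; apply: eq_bigr => i _.
  by rewrite linearZ /= mxE.
have sumE (c : 'I_(\rank (kermx (boundary lam)^T)) -> R) x :
    \sum_i c i *: (X x lam *m b i) = X x lam *m ((\row_i c i) *m B)^T.
  by rewrite -bE mulmx_sumr; apply: eq_bigr => i _; rewrite scalemxAr.
exists (fun i x => X x lam *m b i); split.
- move=> i; apply: frame_eigenfunction; apply: trmx_inj.
  rewrite trmx_mul trmxK trmx0; apply/sub_kermxP.
  by apply: submx_trans (row_sub _ _) _; rewrite eq_row_base.
- move=> c c0 i.
  have : ((\row_i c i) *m B)^T = 0.
    apply: (frame_injective a_norm XZ_sol (lam := lam)) => x x01.
    by rewrite -sumE c0 // subset_oo_cc.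
  move=> /(congr1 trmx); rewrite trmxK trmx0 => /eqP.
  rewrite mulmx_free_eq0 ?row_base_free // => /eqP/rowP/(_ i).
  by rewrite !mxE.
- move=> y /eigenfunction_frame[v [bv yv]].
  have : (v^T <= B)%MS.
    by rewrite eq_row_base; apply/sub_kermxP; rewrite -trmx_mul bv trmx0.
  move=> /submxP[c cv]; exists (fun i => c 0 i) => x x01.
  rewrite sumE yv //; congr (_ *m _); rewrite -[v]trmxK cv; congr (_ *m _)^T.
  by apply/rowP => i; rewrite mxE.
Qed.

Lemma is_eigenvalue_boundary lam :
  is_eigenvalue (schrodinger V a1 a2 b1 b2) lam <-> multiplicity lam != 0%N.
Proof.
split.
  move=> [y /eigenfunction_frame[v [bv yv]] [x x01 yx0]].
  apply: contraNneq yx0 => m0; rewrite yv //.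
  suff -> : v = 0 by rewrite mulmx0.
  have : row_full (boundary lam).
    by rewrite -col_leq_rank; move/eqP: m0; rewrite /multiplicity subn_eq0.
  rewrite row_full_unit => bu.
  by rewrite -[v](mulKmx bu) bv mulmx0.
move=> m0; have : kermx (boundary lam)^T != 0.
  by rewrite -mxrank_eq0 mxrank_ker mxrank_tr.
move=> /rowV0Pn[u /sub_kermxP ub u0].
have bu : boundary lam *m u^T = 0 by rewrite -[boundary lam]trmxK -trmx_mul ub trmx0.
exists (fun x => X x lam *m u^T); first exact: frame_eigenfunction.
apply: contrapT => noX; case/eqP: u0; apply: trmx_inj; rewrite trmx0.
apply: (frame_injective a_norm XZ_sol (lam := lam)) => x x01.
apply/eqP/negPn/negP => Xu; apply: noX; exists x => //; exact: subset_oo_cc.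
Qed.

End BoundaryValue.

(** * The unitary matrix of a pair of Lagrangian subspaces *)

Section ComplexMatrix.
Context {R : realType} {n : nat}.

Definition cplx (A B : 'M[R]_n) : 'M[R[i]]_n := cmx A + 'i%C *: cmx B.

Lemma cplxE (A B : 'M[R]_n) i j : cplx A B i j = (A i j +i* B i j)%C.
Proof.
rewrite !mxE; apply/eqP; rewrite eq_complex /=; apply/andP; split; apply/eqP; ring.
Qed.

Lemma cplxP (M N : 'M[R[i]]_n) :
  (forall i j, complex.Re (M i j) = complex.Re (N i j) /\
               complex.Im (M i j) = complex.Im (N i j)) -> M = N.
Proof.
move=> MN; apply/matrixP => i j; have [] := MN i j.
by case: (M i j) (N i j) => [a b] [c d] /= -> ->.
Qed.

Lemma cplxM (A B A' B' : 'M[R]_n) :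
  cplx A B *m cplx A' B' = cplx (A *m A' - B *m B') (A *m B' + B *m A').
Proof.
rewrite /cplx mulmxDl !mulmxDr -!scalemxAl -!scalemxAr scalerA.
have -> : 'i%C * 'i%C = -1 :> R[i] by apply/eqP; rewrite eq_complex /=; apply/andP; split; apply/eqP; ring.
rewrite /cmx !map_mxB !map_mxD !map_mxM scaleN1r scalerDr.
by rewrite [X in _ + X = _]addrC addrACA.
Qed.

Lemma cplx1 : cplx 1%:M 0 = 1%:M.
Proof. by rewrite /cplx /cmx map_mx1 map_mx0 scaler0 addr0. Qed.

Lemma unitmx_col_inj (F : fieldType) m (A : 'M[F]_m) :
  (forall u : 'cV_m, A *m u = 0 -> u = 0) -> A \in unitmx.
Proof.
move=> Ainj; rewrite -unitmx_tr -row_free_unit -kermx_eq0.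
apply/eqP/row_matrixP => i; rewrite row0; apply: trmx_inj; rewrite trmx0.
apply: Ainj; apply: trmx_inj; rewrite trmx_mul trmxK trmx0.
by apply/sub_kermxP; exact: row_sub.
Qed.

Lemma expiN (t : R) : expi (pi + t) = - expi t.
Proof.
apply/eqP; rewrite eq_complex /= [pi + t]addrC cosDpi sinDpi.
by rewrite !eqxx.
Qed.

(** Multiplying on the left by U' and on the right by U Ub' A' turns
A A'^-1 Ub U' into U' A, and 1 into Ub' A'. *)
Lemma rank_conjugate (F : fieldType) m (A A' U U' Ub Ub' : 'M[F]_m) (c : F) :
    U' *m U = 1%:M -> Ub' *m Ub = 1%:M -> A' \in unitmx ->
  \rank (c%:M - A *m invmx A' *m Ub *m U') = \rank (U' *m A - c *: (Ub' *m A')).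
Proof.
move=> U'U Ub'Ub A'u; set W := A *m _ *m _ *m _.
have WE : U' *m W *m (U *m (Ub' *m A')) = U' *m A.
  rewrite /W -!mulmxA (mulmxA U' U (Ub' *m A')) U'U mul1mx (mulmxA Ub Ub') (mulmx1C Ub'Ub).
  by rewrite mul1mx mulVmx // mulmx1.
have key : U' *m (c%:M - W) *m (U *m (Ub' *m A')) = - (U' *m A - c *: (Ub' *m A')).
  rewrite mulmxBr mulmxBl WE mul_mx_scalar -scalemxAl.
  by rewrite (mulmxA U' U) U'U mul1mx opprB.
have [U'u Uu] := mulmx1_unit U'U; have [Ub'u _] := mulmx1_unit Ub'Ub.
have Cu : U *m (Ub' *m A') \in unitmx by rewrite !unitmx_mul Uu Ub'u.
rewrite -[RHS]mxrank_opp -key [RHS]mxrankMfree ?row_free_unit //.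
by rewrite -[RHS]mxrank_tr trmx_mul mxrankMfree ?mxrank_tr // row_free_unit unitmx_tr.
Qed.

Section MaslovMatrix.
Variables b1 b2 X Z : 'M[R]_n.
Hypothesis b_lag : b1 *m b2^T - b2 *m b1^T = 0.
Hypothesis b_norm : b1 *m b1^T + b2 *m b2^T = 1%:M.
Hypothesis XZ_sym : X^T *m Z = Z^T *m X.
Hypothesis XZ_inj : forall u : 'cV_n, X *m u = 0 -> Z *m u = 0 -> u = 0.

(** (P, D) is the frame (X, Z) in the symplectic coordinates in which the subspace with
frame (b2^T, - b1^T) is horizontal. *)
Let P := b2 *m X - b1 *m Z.
Let D := b1 *m X + b2 *m Z.

(** Its kernel describes the intersection of the subspace with frame (P, D) and the
horizontal one rotated by theta / 2. *)
Definition angle_matrix (P D : 'M[R]_n) (theta : R) : 'M[R]_n :=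
  cos (theta / 2) *: D - sin (theta / 2) *: P.

(** Since X^T Z is symmetric, (X^T + i Z^T) (X - i Z) is the positive definite matrix
X^T X + Z^T Z. *)
Lemma cplx_frame_unit : cplx X (- Z) \in unitmx.
Proof.
have Nu : X^T *m X + Z^T *m Z \in unitmx.
  apply: unitmx_col_inj => u Nu0.
  have : sqnorm (X *m u) + sqnorm (Z *m u) = 0.
    have := congr1 (mulmx u^T) Nu0; rewrite mulmx0 mulmxDl mulmxDr.
    rewrite /sqnorm !trmx_mul !mulmxA => /matrixP/(_ 0 0).
    have add (M N : 'M[R]_1) : (M + N) 0 0 = M 0 0 + N 0 0 by rewrite mxE.
    by move=> h; rewrite -add h mxE.
  have := sqnorm_ge0 (X *m u); have := sqnorm_ge0 (Z *m u) => z0 x0 xz.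
  by apply: XZ_inj; apply: sqnorm_eq0; lra.
have : cplx X^T Z^T *m cplx X (- Z) \in unitmx.
  rewrite cplxM !mulmxN opprK XZ_sym addNr.
  by rewrite /cplx /cmx map_mx0 scaler0 addr0 map_unitmx.
by rewrite unitmx_mul => /andP[].
Qed.

(** With C = P + i D and C' = P - i D, the matrix in question is conjugate to
- C C'^-1, and C - e^{i theta} C' is 2 i e^{i theta / 2} times the matrix on the
right. *)
Lemma rank_maslov_matrix theta :
  \rank (maslov_matrix b1 b2 X Z - (expi (pi + theta))%:M) =
  \rank (angle_matrix P D theta).
Proof.
have bb : b1 *m b2^T = b2 *m b1^T by apply/eqP; rewrite -subr_eq0 b_lag.
have U'U : cplx b2 b1 *m cplx b2^T (- b1^T) = 1%:M.
  by rewrite cplxM !mulmxN opprK bb addNr addrC b_norm cplx1.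
have Ub'Ub : cplx b2 (- b1) *m cplx b2^T b1^T = 1%:M.
  by rewrite cplxM !mulNmx opprK bb subrr addrC b_norm cplx1.
have [b21 _] := boundary_dual bb b_norm.
have WE : maslov_matrix b1 b2 X Z =
    - (cplx X Z *m invmx (cplx X (- Z)) *m cplx b2^T b1^T *m cplx b2 b1).
  rewrite -mulmxA -mulmxN /maslov_matrix cplxM -b21.
  have -> : cmx X - 'i%C *: cmx Z = cplx X (- Z) by rewrite /cplx /cmx map_mxN scalerN.
  congr (_ *m _ *m _); apply/cplxP => i j; rewrite /cplx !mxE /=.
  by split; ring.
rewrite WE expiN raddfN /= opprK addrC.
rewrite (rank_conjugate _ _ U'U Ub'Ub cplx_frame_unit).
have -> : cplx b2 b1 *m cplx X Z = cplx P D.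
  by rewrite cplxM /P /D addrC [b2 *m Z + _]addrC.
have -> : cplx b2 (- b1) *m cplx X (- Z) = cplx P (- D).
  rewrite cplxM mulNmx !mulmxN mulNmx opprK /P /D; congr cplx.
  by rewrite -opprD addrC.
have -> : cplx P D - expi theta *: cplx P (- D) =
   (2 * 'i%C * expi (theta / 2)) *: cmx (angle_matrix P D theta).
  apply/cplxP => i j.
  have sub m (M N : 'M[R[i]]_m) k l : (M - N) k l = M k l - N k l by rewrite !mxE.
  have scale a (M : 'M[R[i]]_n) : (a *: M) i j = a * M i j by rewrite mxE.
  rewrite sub !scale !cplxE [(- D) i j]mxE.
  have -> : cmx (angle_matrix P D theta) i j =
      ((cos (theta / 2) * D i j - sin (theta / 2) * P i j) +i* 0)%C.
    have subR (M N : 'M[R]_n) : (M - N) i j = M i j - N i j by rewrite !mxE.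
    have scaleR a (M : 'M[R]_n) : (a *: M) i j = a * M i j by rewrite mxE.
    by rewrite /angle_matrix /cmx mxE subR !scaleR.
  move: (P i j) (D i j) => p q.
  have -> : expi theta = expi (theta / 2 + theta / 2) by rewrite -splitr.
  rewrite /expi cosD sinD; move: (theta / 2) => h /=.
  have hp : p * (cos h ^+ 2 + sin h ^+ 2) = p by rewrite cos2Dsin2 mulr1.
  have hq : q * (cos h ^+ 2 + sin h ^+ 2) = q by rewrite cos2Dsin2 mulr1.
  by move: hp hq; rewrite !expr2 => hp hq; split; lra.
rewrite mxrank_scale_nz; first by rewrite /cmx mxrank_map.
rewrite mulf_neq0 //.
  apply/negP; rewrite eq_complex => /andP[_ /eqP] /=; lra.
apply/negP => /eqP[c0 s0]; have := cos2Dsin2 (theta / 2).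
by rewrite c0 s0 !expr0n /= addr0 => /eqP; rewrite eq_sym oner_eq0.
Qed.

Lemma dim_ker_maslov theta :
  dim_ker (maslov_matrix b1 b2 X Z - (expi (pi + theta))%:M) =
  (n - \rank (angle_matrix P D theta))%N.
Proof. by rewrite /dim_ker mxrank_ker mxrank_tr rank_maslov_matrix. Qed.

Lemma eigenvalue_maslov theta :
  ~~ eigenvalue (maslov_matrix b1 b2 X Z) (expi (pi + theta)) =
  (angle_matrix P D theta \in unitmx).
Proof.
rewrite /eigenvalue negbK /eigenspace -mxrank_eq0 mxrank_ker rank_maslov_matrix.
by rewrite subn_eq0 col_leq_rank row_full_unit.
Qed.

End MaslovMatrix.
End ComplexMatrix.

(** * Eigenvalue angles as eigenvalues of a symmetric matrix *)

Section Angles.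
Context {R : realType}.
Implicit Types e theta s : R.

Definition slope e theta : R := sin (theta / 2) / sin ((e - theta) / 2).
(** The inverse of the increasing bijection [slope e] from [0, e) onto [0, +oo). *)
Definition slope_angle e s : R := 2 * atan (s * sin (e / 2) / (1 + s * cos (e / 2))).

Section FixedAngle.
Variable e : R.
Hypothesis e_gt0 : 0 < e.
Hypothesis e_ltpi : e < pi.

Lemma half_angle_itv theta : 0 <= theta -> theta <= e ->
  theta / 2 \in `](- (pi / 2)), (pi / 2)[.
Proof.
move=> t0 te; have p := pi_gt0 R; rewrite in_itv /= -mulNr !ltr_pM2r ?invr_gt0 //.
by rewrite (le_lt_trans te) // (lt_le_trans _ t0) // oppr_lt0.
Qed.

Lemma half_angle theta : 0 <= theta -> theta <= e ->
  0 < cos (theta / 2) /\ (0 < theta -> 0 < sin (theta / 2)).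
Proof.
move=> t0 te; have := half_angle_itv t0 te; rewrite in_itv /= => /andP[h1 h2].
split=> [|tgt]; first by apply: cos_gt0_pihalf; rewrite h1.
by apply: sin_gt0_pihalf; rewrite h2 divr_gt0.
Qed.

Lemma slope_ge0 theta : 0 <= theta -> theta < e -> 0 <= slope e theta.
Proof.
rewrite -(subr_gt0 theta e) => t0 te; have p := pi_gt0 R; (have pe : 0 < pi - e by rewrite subr_gt0); rewrite /slope divr_ge0 //.
  by apply: sin_ge0_pi; apply/andP; split; lra.
by apply: sin_ge0_pi; apply/andP; split; lra.
Qed.

Lemma slope_angle_bounds s : 0 <= s -> 0 <= slope_angle e s < e.
Proof.
move=> s0; have [ce se] := half_angle (ltW e_gt0) (lexx e); have {}se := se e_gt0.
have d0 : 0 < 1 + s * cos (e / 2) by rewrite ltr_pwDl // mulr_ge0 // ltW.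
rewrite /slope_angle; apply/andP; split.
  rewrite mulr_ge0 // -(@atan0 R) le_atan // divr_ge0 ?mulr_ge0 // ltW //.
have p := pi_gt0 R; (have pe : 0 < pi - e by rewrite subr_gt0).
suff : atan (s * sin (e / 2) / (1 + s * cos (e / 2))) < e / 2 by lra.
have he := half_angle_itv (ltW e_gt0) (lexx e).
rewrite -[X in _ < X](tanK he).
apply: lt_atan; rewrite /tan ltr_pdivrMr // mulrDr mulr1 mulrCA divfK ?gt_eqF //.
by rewrite ltrDr divr_gt0.
Qed.

(** Both equations say that tan (theta / 2) = s sin (e / 2) / (1 + s cos (e / 2)). *)
Lemma slopeP s theta : 0 <= s -> 0 <= theta -> theta < e ->
  (s == slope e theta) = (theta == slope_angle e s).
Proof.
move=> s0 t0 te; have p := pi_gt0 R; (have pe : 0 < pi - e by rewrite subr_gt0).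
have [ce se] := half_angle (ltW e_gt0) (lexx e); have {}se := se e_gt0.
have [ct _] := half_angle t0 (ltW te).
have te' := te; rewrite -subr_gt0 in te.
have d0 : 0 < 1 + s * cos (e / 2) by rewrite ltr_pwDl // mulr_ge0 // ltW.
have st : 0 < sin ((e - theta) / 2).
  by apply: sin_gt0_pihalf; apply/andP; split; lra.
have sE : sin ((e - theta) / 2) = sin (e / 2) * cos (theta / 2) - cos (e / 2) * sin (theta / 2).
  by rewrite mulrBl sinB.
have -> : (s == slope e theta) = (sin (theta / 2) * (1 + s * cos (e / 2)) == s * sin (e / 2) * cos (theta / 2)).
  have b0 := lt0r_neq0 st; rewrite /slope; rewrite sE in b0 *.
  apply/eqP/eqP => [->|h]; first by field.
  by apply: (canRL (mulfK b0)); lra.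
have -> : (sin (theta / 2) * (1 + s * cos (e / 2)) == s * sin (e / 2) * cos (theta / 2)) =
   (tan (theta / 2) == s * sin (e / 2) / (1 + s * cos (e / 2))).
  by rewrite /tan eqr_div ?lt0r_neq0.
have th := half_angle_itv t0 (ltW te').
rewrite /slope_angle; apply/eqP/eqP => [<-|tE].
  by rewrite tanK //; lra.
have -> : theta / 2 = atan (s * sin (e / 2) / (1 + s * cos (e / 2))).
  by rewrite {1}tE; lra.
exact: atanK.
Qed.

End FixedAngle.
End Angles.

Section Chart.
Context {R : realType} {n : nat}.
Variables (P D : 'M[R]_n) (e : R).
Hypothesis PD_sym : D^T *m P = P^T *m D.
Hypothesis e_gt0 : 0 < e.
Hypothesis e_ltpi : e < pi.
Let E := angle_matrix P D e.
Hypothesis E_unit : E \in unitmx.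

(** The matrix S of the affine chart of the Lagrangian Grassmannian formed by the
subspaces transversal to the target rotated by e / 2. *)
Definition chart : 'M[R]_n := - (D *m invmx (angle_matrix P D e)).

Lemma chart_sym : chart^T = chart.
Proof.
have DE : D^T *m E = E^T *m D.
  rewrite /E /angle_matrix; have -> : (cos (e / 2) *: D - sin (e / 2) *: P)^T =
     cos (e / 2) *: D^T - sin (e / 2) *: P^T by apply/matrixP => i j; rewrite !mxE.
  by rewrite mulmxBr mulmxBl -!scalemxAl -!scalemxAr PD_sym.
have EtK : (invmx E)^T *m E^T = 1%:M by rewrite -trmx_mul mulmxV // trmx1.
rewrite /chart -/E; have -> : (- (D *m invmx E))^T = - ((invmx E)^T *m D^T).
  by rewrite -trmx_mul; apply/matrixP => i j; rewrite !mxE.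
congr (- _); rewrite -[LHS]mulmx1 -(mulmxV E_unit) mulmxA -(mulmxA _ D^T) DE.
by rewrite !mulmxA EtK mul1mx.
Qed.

(** Eliminating P in favour of E gives
cos (theta / 2) D - sin (theta / 2) P =
(sin ((e - theta) / 2) D + sin (theta / 2) E) / sin (e / 2). *)
Lemma rank_angle_matrix theta : 0 <= theta -> theta < e ->
  \rank (angle_matrix P D theta) = \rank (chart - (slope e theta)%:M).
Proof.
move=> t0; rewrite -(subr_gt0 theta e) => te; have p := pi_gt0 R; (have pe : 0 < pi - e by rewrite subr_gt0).
have [ce se] := half_angle e_ltpi (ltW e_gt0) (lexx e); have {}se := se e_gt0.
have st : 0 < sin ((e - theta) / 2).
  by apply: sin_gt0_pihalf; apply/andP; split; lra.
have sE : sin ((e - theta) / 2) = sin (e / 2) * cos (theta / 2) - cos (e / 2) * sin (theta / 2).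
  by rewrite mulrBl sinB.
have -> : angle_matrix P D theta =
    - (sin ((e - theta) / 2) / sin (e / 2)) *: ((chart - (slope e theta)%:M) *m E).
  rewrite mulmxBl mul_scalar_mx /chart mulNmx -/E mulmxKV //.
  have -> : E = cos (e / 2) *: D - sin (e / 2) *: P by [].
  apply/matrixP => i j; rewrite !mxE /slope sE.
  have : sin (e / 2) * cos (theta / 2) - cos (e / 2) * sin (theta / 2) != 0 by rewrite -sE gt_eqF.
  have : sin (e / 2) != 0 by rewrite gt_eqF.
  move: (sin (e / 2)) (cos (e / 2)) (sin (theta / 2)) (cos (theta / 2)) => a b c d a0 abcd.
  by field; rewrite a0 abcd.
rewrite mxrank_scale_nz ?mxrankMfree ?row_free_unit //.
by rewrite oppr_eq0 mulf_neq0 ?invr_eq0 ?gt_eqF.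
Qed.

Section Spectrum.
Variables (Q : 'M[R]_n) (d : 'rV[R]_n).
Hypothesis SQd : spectral_decomposition chart Q d.

Lemma corank_boundary : (n - \rank D)%N = nb_zero d.
Proof.
rewrite /nb_zero -(corank_spectral SQd) raddf0 subr0 /chart mxrank_opp.
by rewrite mxrankMfree // row_free_unit unitmx_inv.
Qed.

(** The eigenvalue d_i >= 0 of the chart is counted for the single angle
[slope_angle e d_i]. *)
Lemma maslov_count_chart (W : 'M[R[i]]_n) :
    (forall theta, dim_ker (W - (expi (pi + theta))%:M) =
                   (n - \rank (angle_matrix P D theta))%N) ->
  maslov_count W e = (nb_nonneg d)%:Z.
Proof.
move=> WPD; rewrite /maslov_count.
pose r := undup [seq slope_angle e (d 0 i) | i <- [seq i <- enum 'I_n | 0 <= d 0 i]].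
have dimE theta : 0 <= theta -> theta < e ->
    dim_ker (W - (expi (pi + theta))%:M) =
    (\sum_(i < n | (0 <= d 0 i)%R) (theta == slope_angle e (d 0%R i)))%N.
  move=> t0 te; rewrite WPD rank_angle_matrix // (corank_spectral SQd).
  rewrite -sum1_card [RHS]big_mkcond /= [LHS]big_mkcond /=.
  apply: eq_bigr => i _; rewrite inE; have [di|di] := lerP 0 (d 0 i).
    by rewrite slopeP //; case: eqP.
  by rewrite lt_eqF // (lt_le_trans di) // slope_ge0.
have rP t : t \in r -> 0 <= t < e.
  rewrite mem_undup => h; have [i + ->] := elimT mapP h; rewrite mem_filter => /andP[di _]. 
  exact: slope_angle_bounds.
have rT i : 0 <= d 0 i -> slope_angle e (d 0 i) \in r.
  by move=> di; rewrite mem_undup; apply: map_f; rewrite mem_filter di mem_enum.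
rewrite (fsbigE r) ?undup_uniq //; last first.
  move=> t /= /andP[t0 te] tr; rewrite dimE // big1 // => i di.
  by case: eqP => // tE; case/negP: tr; rewrite tE; exact: rT.
have -> : \sum_(t <- r | t \in [set theta | 0 <= theta < e])
      (dim_ker (W - (expi (pi + t))%:M))%:Z =
    \sum_(t <- r) (\sum_(i < n | (0 <= d 0 i)%R) (t == slope_angle e (d 0%R i)))%N%:Z.
  rewrite big_seq_cond [RHS]big_seq_cond; apply: eq_big => t.
    by rewrite andbT andb_idr // => /rP; rewrite inE.
  by move=> /andP[/rP/andP[t0 te] _]; rewrite dimE.
rewrite -(big_morph _ PoszD (erefl _)) exchange_big /=; congr Posz.
rewrite /nb_nonneg -sum1dep_card; apply: eq_bigr => i di.
rewrite (bigD1_seq _ (rT i di)) ?undup_uniq //= eqxx big1 ?addn0 // => t.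
by move=> /negPf ->.
Qed.

End Spectrum.
End Chart.

(** * Monotonicity of the chart *)

Section Limits.
Context {R : realType}.

Lemma cvg_invmx (T : Type) (F : set_system T) (FF : Filter F) n
    (M : T -> 'M[R]_n) (L : 'M[R]_n) :
  L \in unitmx -> M t @[t --> F] --> L -> invmx (M t) @[t --> F] --> invmx L.
Proof.
move=> Lu ML; have dL := cvg_det FF ML.
have dL0 : \det L != 0 by move: Lu; rewrite unitmxE unitfE.
have nu : \forall t \near F, M t \in unitmx.
  have : \forall t \near F, \det (M t) != 0 by exact: (cvgr_neq0 _ dL dL0).
  by apply: filterS => t; rewrite unitmxE unitfE.
have main : ((\det (M t))^-1 *: \adj (M t)) @[t --> F] --> invmx L.
  rewrite /invmx Lu; apply: cvgZ; first exact: cvgV.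
  apply/cvg_mxP => i j; rewrite mxE; under eq_cvg do rewrite mxE.
  rewrite /cofactor; apply: cvgM; first exact: cvg_cst.
  apply: cvg_det; apply/cvg_mxP => k l; rewrite !mxE; under eq_cvg do rewrite !mxE.
  by move/cvg_mxP: ML; apply.
apply: cvg_trans main; apply: near_eq_cvg.
by apply: filterS nu => t tu; rewrite /invmx tu.
Qed.

Lemma qform_sqnorm n (M : 'M[R]_n) (u : 'rV_n) :
  qform M u = ((u^T)^T *m M *m u^T) 0 0.
Proof. by rewrite trmxK. Qed.

Lemma qform_le n (M : 'M[R]_n) (c : R) (u : 'rV_n) : 0 <= c ->
  (forall i j, `|M i j| <= c / (2 * n.+1%:R)) -> `|qform M u| <= c * qform 1%:M u.
Proof.
move=> c0 Mc; rewrite qform_sqnorm; apply: le_trans (bilinear_bound _ _ Mc) _.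
have -> : qform 1%:M u = sqnorm u^T by rewrite /qform /sqnorm mulmx1 trmxK.
have s0 := sqnorm_ge0 u^T.
have -> : c / (2 * n.+1%:R) * n%:R * (sqnorm u^T + sqnorm u^T) =
   c * sqnorm u^T * (n%:R / n.+1%:R).
  by field; rewrite nat1r pnatr_eq0.
by rewrite ler_piMr ?mulr_ge0 // ler_pdivrMr ?ltr0n // mul1r ler_nat.
Qed.

Lemma near_qform_le (T : Type) (F : set_system T) (FF : Filter F) n
    (M : T -> 'M[R]_n) (L : 'M[R]_n) (c : R) :
  M t @[t --> F] --> L -> 0 < c ->
  \forall t \near F, forall u, `|qform (M t - L) u| <= c * qform 1%:M u.
Proof.
move=> ML c0; have e0 : 0 < c / (2 * n.+1%:R) by rewrite divr_gt0 // mulr_gt0.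
suff : \forall t \near F, forall ij : 'I_n * 'I_n,
    `|L ij.1 ij.2 - M t ij.1 ij.2| <= c / (2 * n.+1%:R).
  apply: filterS => t h u; apply: qform_le (ltW c0) _ => i j.
  by have := h (i, j); rewrite /= distrC !mxE.
apply: filter_forall => ij.
by move/cvg_mxP: ML => /(_ ij.1 ij.2) /cvgrPdist_le /(_ _ e0).
Qed.

(** The eigenvalues of the limit are bounded below by some c > 0, and a form within
c / 2 of it is still positive. *)
Lemma near_posdef (T : Type) (F : set_system T) (FF : Filter F) n
    (K : T -> 'M[R]_n) (L : 'M[R]_n) :
  K t @[t --> F] --> L -> L^T = L -> posdef L -> \forall t \near F, posdef (K t).
Proof.
move=> KL Lsym Lpos; have [Q [d LQd]] := symmetric_spectral Lsym.
have [c c0 cd] := spectral_gap d.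
have dpos i : 0 < d 0 i.
  have ei : delta_mx 0 i *m Q != 0 :> 'rV[R]_n.
    apply/eqP => /(congr1 (mulmx^~ Q^T)); rewrite -mulmxA (proj1 LQd) mulmx1 mul0mx.
    by move=> /matrixP/(_ 0 i) /eqP; rewrite !mxE !eqxx oner_eq0.
  have := Lpos _ ei; rewrite (qform_spectral LQd) -mulmxA (proj1 LQd) mulmx1.
  rewrite (bigD1 i) //= big1 => [|j ji].
    by rewrite !mxE !eqxx expr1n mulr1 addr0.
  by rewrite !mxE (negPf ji) andbF expr0n mulr0.
have c2 : 0 < c / 2 by rewrite divr_gt0.
apply: filterS (near_qform_le FF KL c2) => t near u u0.
have := near u; rewrite ler_norml qformB => /andP[h _].
have q0 : 0 < qform 1%:M u by rewrite qform1_gt0.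
have : c * qform 1%:M u <= qform L u.
  rewrite (qform1_spectral LQd) (qform_spectral LQd) mulr_sumr; apply: ler_sum => i _.
  apply: ler_wpM2r; first exact: sqr_ge0.
  by rewrite -[d 0 i]gtr0_norm // cd // gt_eqF.
have : 0 < c * qform 1%:M u by rewrite mulr_gt0.
move: h; rewrite mulrAC; lra.
Qed.

End Limits.

Section Crossing.
Context {R : realType} {n : nat}.
Variables (V : R -> 'M[R]_n) (a1 a2 b1 b2 : 'M[R]_n).
Hypothesis V_cont : {within `[(0 : R), 1], continuous V}.
Hypothesis V_sym : forall x, x \in `[(0 : R), 1] -> (V x)^T = V x.
Hypothesis a_lag : a1 *m a2^T - a2 *m a1^T = 0.
Hypothesis b_lag : b1 *m b2^T - b2 *m b1^T = 0.
Hypothesis a_norm : a1 *m a1^T + a2 *m a2^T = 1%:M.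
Hypothesis b_norm : b1 *m b1^T + b2 *m b2^T = 1%:M.
Variables X Z : R -> R -> 'M[R]_n.
Hypothesis XZ_sol : forall lam : R,
  frame_solution V a1 a2 lam (fun x => X x lam) (fun x => Z x lam).

Local Notation D := (boundary b1 b2 X Z).
Definition coboundary lam : 'M[R]_n := b2 *m X 1 lam - b1 *m Z 1 lam.
Local Notation P := coboundary.
Definition angle e lam := angle_matrix (P lam) (D lam) e.
Definition frame_matrix lam := maslov_matrix b1 b2 (X 1 lam) (Z 1 lam).
Local Notation chart_at e lam := (chart (P lam) (D lam) e).

Let one01 : (1 : R) \in `[(0 : R), 1].
Proof. by rewrite in_itv /= lexx ler01. Qed.

Let addE (M N : 'M[R]_n) i j : (M + N) i j = M i j + N i j.
Proof. by rewrite mxE. Qed.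
Let oppE (M : 'M[R]_n) i j : (- M) i j = - M i j.
Proof. by rewrite mxE. Qed.
Let scaleE c (M : 'M[R]_n) i j : (c *: M) i j = c * M i j.
Proof. by rewrite mxE. Qed.

(** The change of coordinates from (X, Z) to (P, D) is symplectic. *)
Lemma wronskian_boundary mu lam :
  (P mu)^T *m D lam - (D mu)^T *m P lam = wronskian X Z 1 mu lam.
Proof.
have bb : b1 *m b2^T = b2 *m b1^T by apply/eqP; rewrite -subr_eq0 b_lag.
have [b21 b11] := boundary_dual bb b_norm.
rewrite /coboundary /boundary /wronskian.
move: (X 1 mu) (Z 1 mu) (X 1 lam) (Z 1 lam) => X' Z' X1 Z1.
have -> : (b2 *m X' - b1 *m Z')^T = X'^T *m b2^T - Z'^T *m b1^T.
  by rewrite -!trmx_mul linearB.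
have -> : (b1 *m X' + b2 *m Z')^T = X'^T *m b1^T + Z'^T *m b2^T.
  by rewrite -!trmx_mul linearD.
have -> : X'^T *m Z1 = X'^T *m (b1^T *m b1 + b2^T *m b2) *m Z1 by rewrite b11 mulmx1.
have -> : Z'^T *m X1 = Z'^T *m (b1^T *m b1 + b2^T *m b2) *m X1 by rewrite b11 mulmx1.
rewrite !(mulmxDr, mulmxDl, mulmxBr, mulmxBl, mulmxN, mulNmx) !mulmxA.
rewrite -[_ *m b2^T *m b1]mulmxA b21 -[_ *m b2^T *m b1]mulmxA b21 !mulmxA.
by apply/matrixP => i j; rewrite !(addE, oppE); ring.
Qed.

Lemma boundary_sym lam : (D lam)^T *m P lam = (P lam)^T *m D lam.
Proof.
apply/eqP; rewrite eq_sym -subr_eq0 wronskian_boundary /wronskian.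
by rewrite (frame_symmetric V_sym a_lag XZ_sol) subrr.
Qed.

(** Writing the first chart as its transpose - E_mu^-T D_mu^T leaves
E_mu^T D_lam - D_mu^T E_lam between the two inverses, which is - sin (e / 2) times
the Wronskian. *)
Lemma chart_diff e mu lam : angle e mu \in unitmx -> angle e lam \in unitmx ->
  chart_at e mu - chart_at e lam = - sin (e / 2) *:
    ((invmx (angle e mu))^T *m wronskian X Z 1 mu lam *m invmx (angle e lam)).
Proof.
move=> mu_unit lam_unit; rewrite -(chart_sym (boundary_sym mu) mu_unit).
have EK : invmx (angle e mu) *m angle e mu = 1%:M by rewrite mulVmx.
have -> : (chart_at e mu)^T = - ((invmx (angle e mu))^T *m (D mu)^T).
  by rewrite /chart -trmx_mul linearN.
have -> : chart_at e lam = - ((invmx (angle e mu))^T *m (angle e mu)^T *m D lam *m invmx (angle e lam)).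
  by rewrite -trmx_mul mulmxV // trmx1 mul1mx.
have -> : (D mu)^T = (D mu)^T *m angle e lam *m invmx (angle e lam).
  by rewrite mulmxK.
have aT : (angle e mu)^T = cos (e / 2) *: (D mu)^T - sin (e / 2) *: (P mu)^T.
  by apply/matrixP => i j; rewrite !mxE.
rewrite opprK !mulmxA -mulNmx -mulmxDl scalemxAl; congr (_ *m _).
rewrite -!mulmxA -mulmxN -mulmxDr scalemxAr; congr (_ *m _).
rewrite -wronskian_boundary aT {1}/angle /angle_matrix mulmxBr mulmxBl -!scalemxAl -!scalemxAr.
by apply/matrixP => i j; rewrite !(addE, oppE, scaleE, addE, oppE); ring.
Qed.

Lemma frame_continuous lam :
  X 1 mu @[mu --> lam] --> X 1 lam /\ Z 1 mu @[mu --> lam] --> Z 1 lam.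
Proof.
have [C C0 XC] := frame_lipschitz V_cont XZ_sol lam.
have lip (f : R -> R) : (forall mu, `|mu - lam| <= 1 -> `|f mu - f lam| <= C * `|mu - lam|) ->
    f mu @[mu --> lam] --> f lam.
  move=> fC; apply/cvgrPdist_le => e e0; near=> mu.
  have h1 : `|mu - lam| <= 1.
    by rewrite distrC; near: mu; exact: (@cvgr_dist_le _ _ _ _ _ id lam cvg_id).
  have h2 : `|mu - lam| <= e / (1 + C).
    rewrite distrC; near: mu; apply: (@cvgr_dist_le _ _ _ _ _ id lam cvg_id).
    by rewrite divr_gt0 // ltr_pwDl.
  rewrite distrC; apply: le_trans (fC _ h1) _.
  move: h2; rewrite ler_pdivlMr ?ltr_pwDl // => h2.
  by have := normr_ge0 (mu - lam); lra.
split; apply/cvg_mxP => i j; apply: lip => mu h.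
  by have [] := XC mu 1 i j h one01.
by have [] := XC mu 1 i j h one01.
Unshelve. all: by end_near. Qed.

Lemma angle_continuous e lam : angle e mu @[mu --> lam] --> angle e lam.
Proof.
have [cX cZ] := frame_continuous lam; rewrite /angle /angle_matrix.
apply: cvgB; apply: cvgZr => //.
  by apply: cvgD; apply: cvg_mulmx => //; exact: cvg_cst.
by apply: cvgB; apply: cvg_mulmx => //; exact: cvg_cst.
Qed.

Lemma near_angle_unit e lam : angle e lam \in unitmx ->
  \forall mu \near lam, angle e mu \in unitmx.
Proof.
rewrite unitmxE unitfE => d0.
have dL : \det (angle e mu) @[mu --> lam] --> \det (angle e lam).
  by apply: cvg_det; exact: angle_continuous.
have : \forall mu \near lam, \det (angle e mu) != 0 by exact: (cvgr_neq0 (\det (angle e lam)) dL d0).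
by apply: filterS => mu; rewrite unitmxE unitfE.
Qed.

Lemma wronskian_quotient lam :
  (mu - lam)^-1 *: wronskian X Z 1 mu lam @[mu --> lam^'] --> gram X 1 lam.
Proof.
have [C C0 WC] := wronskian_gram V_cont V_sym a_lag XZ_sol lam.
apply/cvg_mxP => i j; apply/cvgrPdist_le => e e0; near=> mu.
have mu_neq : mu != lam by near: mu; exact: nbhs_dnbhs_neq.
have h1 : `|mu - lam| <= 1.
  by rewrite distrC; near: mu; apply: cvg_within; exact: (@cvgr_dist_le _ _ _ _ _ id lam cvg_id).
have h2 : `|mu - lam| <= e / (1 + C).
  rewrite distrC; near: mu; apply: cvg_within; apply: (@cvgr_dist_le _ _ _ _ _ id lam cvg_id).
  by rewrite divr_gt0 // ltr_pwDl.
have d0 : mu - lam != 0 by rewrite subr_eq0.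
have nd0 : 0 < `|mu - lam| by rewrite normr_gt0.
rewrite distrC mxE -[gram X 1 lam i j](mulKf d0) -mulrBr normrM normfV.
rewrite mulrC ler_pdivrMr //; apply: le_trans (WC mu i j h1) _.
move: h2; rewrite ler_pdivlMr ?ltr_pwDl // => h2.
rewrite expr2 mulrA ler_pM2r //; lra.
Unshelve. all: by end_near. Qed.

Lemma gram_sym lam : (gram X 1 lam)^T = gram X 1 lam.
Proof.
apply/matrixP => i j; rewrite !mxE; apply: eq_Rintegral => x _.
have /matrixP/(_ i j) : ((X x lam)^T *m X x lam)^T = (X x lam)^T *m X x lam.
  by rewrite trmx_mul trmxK.
by rewrite mxE.
Qed.

Local Notation mult lam := (multiplicity b1 b2 X Z lam).
Definition count e lam := maslov_count (frame_matrix lam) e.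

Lemma frame_matrix_dim_ker lam theta :
  dim_ker (frame_matrix lam - (expi (pi + theta))%:M) =
  (n - \rank (angle theta lam))%N.
Proof.
apply: dim_ker_maslov => //; first exact: (frame_symmetric V_sym a_lag XZ_sol).
exact: (frame_injective_end V_cont a_norm XZ_sol).
Qed.

Lemma frame_matrix_eigenvalue lam theta :
  ~~ eigenvalue (frame_matrix lam) (expi (pi + theta)) = (angle theta lam \in unitmx).
Proof.
apply: eigenvalue_maslov => //; first exact: (frame_symmetric V_sym a_lag XZ_sol).
exact: (frame_injective_end V_cont a_norm XZ_sol).
Qed.

Section Step.
Variables e lam : R.
Hypothesis e_gt0 : 0 < e.
Hypothesis e_ltpi : e < pi.

Lemma count_spectral mu Q d : angle e mu \in unitmx ->
  spectral_decomposition (chart_at e mu) Q d ->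
  count e mu = (nb_nonneg d)%:Z /\ mult mu = nb_zero d.
Proof.
move=> mu_unit SQd; split; last exact: corank_boundary mu_unit _ _ SQd.
apply: (maslov_count_chart e_gt0 e_ltpi mu_unit SQd) => theta.
exact: frame_matrix_dim_ker.
Qed.

Hypothesis lam_unit : angle e lam \in unitmx.

Lemma qformZ c (M : 'M[R]_n) u : qform (c *: M) u = c * qform M u.
Proof. by rewrite /qform -scalemxAr -scalemxAl mxE. Qed.

(** The limit of [K mu] as mu tends to lam. *)
Let K0 := (invmx (angle e lam))^T *m gram X 1 lam *m invmx (angle e lam).
Let K mu := (invmx (angle e mu))^T *m
  ((mu - lam)^-1 *: wronskian X Z 1 mu lam) *m invmx (angle e lam).

(** The limit is congruent to the positive definite matrix [gram X 1 lam]. *)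
Lemma chart_rate_posdef : \forall mu \near lam^', posdef (K mu).
Proof.
have KK0 : K mu @[mu --> lam^'] --> K0.
  apply: cvg_mulmx; last exact: cvg_cst.
  apply: cvg_mulmx; last exact: wronskian_quotient.
  apply: cvg_trmx; apply: (cvg_invmx _ lam_unit).
  by apply: cvg_within_filter; exact: angle_continuous.
apply: (near_posdef _ KK0).
  by rewrite /K0 !trmx_mul trmxK gram_sym mulmxA.
move=> u u0; have := gram_posdef a_norm XZ_sol lam (u := u *m (invmx (angle e lam))^T).
rewrite /qform /K0 !trmx_mul trmxK !mulmxA; apply.
apply: contraNneq u0 => /(congr1 (mulmx^~ (angle e lam)^T)).
by rewrite mul0mx -mulmxA -trmx_mul mulmxV // trmx1 mulmx1 => ->.
Qed.

Lemma chart_near c : 0 < c -> \forall mu \near lam,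
  forall u, `|qform (chart_at e mu - chart_at e lam) u| <= c * qform 1%:M u.
Proof.
move=> c0; suff cS : chart_at e mu @[mu --> lam] --> chart_at e lam by exact: near_qform_le cS c0.
have [cX cZ] := frame_continuous lam; rewrite /chart; apply: cvgN.
apply: cvg_mulmx; last by apply: (cvg_invmx _ lam_unit); exact: angle_continuous.
by apply: cvgD; apply: cvg_mulmx => //; exact: cvg_cst.
Qed.

(** [chart_diff] and [chart_rate_posdef] make the chart strictly larger for mu < lam
and strictly smaller for mu > lam, and [inertia_jump] applies. *)
Lemma count_step : \forall mu \near lam^',
  [/\ angle e mu \in unitmx, mult mu = 0%N,
      mu < lam -> count e mu = count e lam &
      lam < mu -> count e lam = count e mu + (mult lam)%:Z].
Proof.
have [Q [d SQd]] := symmetric_spectral (chart_sym (boundary_sym lam) lam_unit).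
have [c c0 cS] := inertia_jump SQd.
have [cl ml] := count_spectral lam_unit SQd.
have s0 : 0 < sin (e / 2).
  have [_ h] := half_angle e_ltpi (ltW e_gt0) (lexx e); exact: h.
have nunit : \forall mu \near lam^', angle e mu \in unitmx.
  by apply: cvg_within; exact: near_angle_unit.
have nclose : \forall mu \near lam^',
    forall u, `|qform (chart_at e mu - chart_at e lam) u| <= c * qform 1%:M u.
  by apply: cvg_within; exact: chart_near.
near=> mu.
have mu_neq : mu != lam by near: mu; exact: nbhs_dnbhs_neq.
have mu_unit : angle e mu \in unitmx by near: mu.
have Kpos : posdef (K mu) by near: mu; exact: chart_rate_posdef.
have close : forall u, `|qform (chart_at e mu - chart_at e lam) u| <= c * qform 1%:M u by near: mu.
have [Q' [d' SQd']] := symmetric_spectral (chart_sym (boundary_sym mu) mu_unit).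
have [cm mm] := count_spectral mu_unit SQd'.
have [after before] := cS _ _ _ SQd' close.
have SK : chart_at e mu - chart_at e lam = (- (mu - lam) * sin (e / 2)) *: K mu.
  rewrite chart_diff // /K -scalemxAr -scalemxAl scalerA; congr (_ *: _).
  by rewrite mulrAC mulNr mulrV ?unitfE ?subr_eq0 // mulN1r.
have up : mu < lam -> posdef (chart_at e mu - chart_at e lam).
  move=> lt_mu u u0; rewrite SK qformZ mulr_gt0 ?Kpos // mulr_gt0 //.
  by rewrite oppr_gt0 subr_lt0.
have down : lam < mu -> posdef (chart_at e lam - chart_at e mu).
  move=> gt_mu u u0; rewrite -opprB SK -scaleNr qformZ mulr_gt0 ?Kpos //.
  by rewrite -mulNr opprK mulr_gt0 // subr_gt0.
rewrite cl cm ml mm; case: (ltgtP mu lam) mu_neq => // [lt_mu|gt_mu] _.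
  by have [-> ->] := after (up lt_mu).
by have [-> ->] := before (down gt_mu).
Unshelve. all: by end_near. Qed.

End Step.

Lemma count_path e t :
  maslov_count (path_matrix b1 b2 X Z (@Gamma3 R) t) e = count e (- t).
Proof. by []. Qed.

Lemma path_matrix_eigenvalue t theta :
  ~~ eigenvalue (path_matrix b1 b2 X Z (@Gamma3 R) t) (expi (pi + theta)) =
  (angle theta (- t) \in unitmx).
Proof. exact: frame_matrix_eigenvalue. Qed.

End Crossing.

(* Unfolding these two constants would make conversion compute matrix ranks. *)
Local Opaque count multiplicity.

(** * Counting the crossings *)

Section Flow.
Context {R : realType} {n : nat}.
Variables (V : R -> 'M[R]_n) (a1 a2 b1 b2 : 'M[R]_n).
Hypothesis V_cont : {within `[(0 : R), 1], continuous V}.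
Hypothesis V_sym : forall x, x \in `[(0 : R), 1] -> (V x)^T = V x.
Hypothesis a_lag : a1 *m a2^T - a2 *m a1^T = 0.
Hypothesis b_lag : b1 *m b2^T - b2 *m b1^T = 0.
Hypothesis a_norm : a1 *m a1^T + a2 *m a2^T = 1%:M.
Hypothesis b_norm : b1 *m b1^T + b2 *m b2^T = 1%:M.
Variables X Z : R -> R -> 'M[R]_n.
Hypothesis XZ_sol : forall lam : R,
  frame_solution V a1 a2 lam (fun x => X x lam) (fun x => Z x lam).

(** Among n + 1 candidates 1 / (k + 1) for e one is suitable: otherwise each of them
would give an eigenvalue, and these are distinct, having the distinct real parts
- cos (1 / (k + 1)). *)
Lemma noneigenvalue_angle (A : 'M[R[i]]_n) : exists2 e : R, 0 < e < pi &
  ~~ eigenvalue A (expi (pi + e)) /\ ~~ eigenvalue A (expi (pi - e)).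
Proof.
pose ang (k : 'I_n.+1) : R := k.+1%:R^-1.
have ang0 k : 0 < ang k by rewrite invr_gt0 ltr0n.
have angpi k : ang k < pi.
  have k1 : ang k <= 1 by rewrite invf_le1 ?ltr0n // ler1n.
  by apply: le_lt_trans k1 _; apply: lt_le_trans (pi_ge2 R); rewrite ltr1n.
apply: contrapT => no.
have eig k : eigenvalue A (expi (pi + ang k)) || eigenvalue A (expi (pi - ang k)).
  apply/negPn/negP; rewrite negb_or => /andP[h1 h2]; apply: no.
  by exists (ang k) => //; rewrite ang0 angpi.
pose z k := if eigenvalue A (expi (pi + ang k)) then expi (pi + ang k)
            else expi (pi - ang k).
have zE k : complex.Re (z k) = - cos (ang k).
  by rewrite /z; case: ifP => _ /=; rewrite addrC cosDpi ?cosN.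
have z_inj : injective z.
  move=> k l /(congr1 (@complex.Re R)); rewrite !zE => /oppr_inj /cos_inj.
  have itv j : ang j \in `[0, pi] by rewrite in_itv /= !ltW.
  move=> /(_ (itv k) (itv l)) /invr_inj /eqP; rewrite eqr_nat => /eqP[kl].
  exact: val_inj.
have cp0 : char_poly A != 0 by rewrite monic_neq0 // char_poly_monic.
have := max_poly_roots cp0 (rs := [seq z k | k <- enum 'I_n.+1]).
rewrite map_inj_uniq // enum_uniq size_map size_enum_ord size_char_poly ltnn.
move=> /(_ _ isT) h; apply: notF; apply: h.
apply/allP => w /mapP[k _ ->]; rewrite -eigenvalue_root_char /z.
by case: ifP => // nk; have := eig k; rewrite nk.
Qed.

Local Notation W := (path_matrix b1 b2 X Z (@Gamma3 R)).
Local Notation angle := (angle b1 b2 X Z).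
Local Notation count := (count b1 b2 X Z).
Local Notation mult := (multiplicity b1 b2 X Z).

Lemma near_opp (t : R) (Q : R -> Prop) : (\forall mu \near (- t), Q mu) ->
  exists2 r : R, 0 < r & forall t', `|t' - t| < r -> Q (- t').
Proof.
move=> /nbhs_ballP[r r0 rQ]; exists r => // t' tt'; apply: rQ.
by rewrite /ball /= opprK addrC.
Qed.

(** [count_step] read along the path lam = - t. *)
Lemma count_step_path e t : 0 < e -> e < pi -> angle e (- t) \in unitmx ->
  exists2 r : R, 0 < r & forall t', `|t' - t| < r -> t' != t ->
    [/\ mult (- t') = 0%N,
        t < t' -> count e (- t') = count e (- t) &
        t' < t -> count e (- t) = count e (- t') + (mult (- t))%:Z].
Proof.
move=> e0 epi t_unit.
have step : \forall mu \near (- t), mu != - t ->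
    [/\ angle e mu \in unitmx, mult mu = 0%N,
        mu < - t -> count e mu = count e (- t) &
        - t < mu -> count e (- t) = count e mu + (mult (- t))%:Z].
  exact: (count_step V_cont V_sym a_lag b_lag a_norm b_norm XZ_sol e0 epi t_unit).
have [r r0 rQ] := near_opp step.
exists r; first exact: r0.
move=> t' tt' t't.
have := rQ t' tt'; rewrite eqr_opp => /(_ t't)[_ m up down].
split; first exact: m.
  by move=> h; apply: up; rewrite ltrN2.
by move=> h; apply: down; rewrite ltrN2.
Qed.

Lemma good_angle t : exists2 e : R, 0 < e < pi &
  angle e (- t) \in unitmx /\ angle (- e) (- t) \in unitmx.
Proof.
have [e epi [h1 h2]] := noneigenvalue_angle (W t).
by exists e => //; rewrite -!(path_matrix_eigenvalue V_cont V_sym a_lag b_lag a_norm b_norm XZ_sol).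
Qed.

Lemma crossings_finite a b : a <= b -> exists s : seq R,
  forall t, a <= t <= b -> mult (- t) != 0%N -> t \in s.
Proof.
move=> ab; apply: (interval_induction (Q := fun a b => exists s : seq R,
  forall t, a <= t <= b -> mult (- t) != 0%N -> t \in s)) ab _ _.
  move=> x y z _ xy yz _ [s1 h1] [s2 h2]; exists (s1 ++ s2) => t /andP[xt tz] mt.
  rewrite mem_cat; case: (leP t y) => ty.
    by rewrite h1 // xt.
  by rewrite (h2 t) ?orbT // tz ltW.
move=> t _; have [e /andP[e0 epi] [t_unit _]] := good_angle t.
have [r r0 rQ] := count_step_path e0 epi t_unit.
have iso t' : `|t' - t| < r -> mult (- t') != 0%N -> t' \in [:: t].
  move=> tr; rewrite inE; have [//|t't] := eqVneq t' t.
  by have [->] := rQ t' tr t't.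
exists r => //; split=> x /andP[h1 h2] _; exists [:: t] => t' /andP[h3 h4]; apply: iso.
  by rewrite ger0_norm ?subr_ge0 // ltrBlDl (le_lt_trans h4).
by rewrite ler0_norm ?subr_le0 // opprB ltrBlDl -ltrBlDr (lt_le_trans h1).
Qed.

Definition crossings (s : seq R) a b : nat := \sum_(t <- s | (a < t <= b)%R) mult (- t).

Lemma crossings_cat s a b c : a <= b -> b <= c ->
  crossings s a c = (crossings s a b + crossings s b c)%N.
Proof.
move=> ab bc; rewrite /crossings (bigID (fun t => t <= b)) /=; congr (_ + _)%N.
  apply: eq_bigl => t; case: (leP t b) => tb; rewrite ?andbT ?andbF //.
  by rewrite (le_trans tb bc) andbT.
apply: eq_bigl => t; case: (ltP b t) => tb; rewrite ?andbT ?andbF //.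
by rewrite (le_lt_trans ab tb).
Qed.

(** Between consecutive crossings the number of eigenvalues in the arc is constant, and
it jumps by the multiplicity on arrival at a crossing, as [count_step_path] says. *)
Lemma count_crossings e s a b : 0 < e -> e < pi -> a <= b ->
    (forall t, a <= t <= b -> angle e (- t) \in unitmx) ->
    uniq s -> (forall t, a < t -> mult (- t) != 0%N -> t \in s) ->
  count e (- b) - count e (- a) = (crossings s a b)%:Z.
Proof.
move=> e0 epi ab t_unit us sP.
apply: (interval_induction (Q := fun x y => count e (- y) - count e (- x) =
  (crossings s x y)%:Z)) ab _ _.
  move=> x y z _ xy yz _ Qxy Qyz; rewrite (crossings_cat _ xy yz) PoszD -Qxy -Qyz.
  by move: (count e (- x)) (count e (- y)) (count e (- z)) => p q r; ring.
move=> t atb; have [r r0 rQ] := count_step_path e0 epi (t_unit t atb).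
have empty x : crossings s x x = 0%N.
  by rewrite /crossings big1 // => u /andP[xu ux]; move: (lt_le_trans xu ux); rewrite ltxx.
exists r => //; split=> x /andP[h1 h2] h3.
  move: h1; rewrite le_eqVlt => /predU1P[<-|tx]; first by rewrite subrr empty.
  have xr : `|x - t| < r by rewrite gtr0_norm ?subr_gt0 // ltrBlDl.
  have [_ up _] := rQ x xr (negbT (gt_eqF tx)); rewrite (up tx) {up}.
  rewrite subrr /crossings big1 => [|u /andP[tu ux]]; first exact: erefl.
  have ur : `|u - t| < r by rewrite gtr0_norm ?subr_gt0 // ltrBlDl (le_lt_trans ux).
  by have [mu _ _] := rQ u ur (negbT (gt_eqF tu)); exact: mu.
move: h2; rewrite le_eqVlt => /predU1P[->|xt]; first by rewrite subrr empty.
have xr : `|x - t| < r by rewrite ltr0_norm ?subr_lt0 // opprB ltrBlDl -ltrBlDr.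
have [_ _ down] := rQ x xr (negbT (lt_eqF xt)); rewrite (down xt) {down}.
rewrite addrAC subrr add0r; congr Posz.
have at_ : a < t by apply: le_lt_trans xt.
have small u : x < u <= t -> u != t -> mult (- u) = 0%N.
  move=> /andP[xu ut] ut'.
  have ur : `|u - t| < r.
    by rewrite ler0_norm ?subr_le0 // opprB ltrBlDl -ltrBlDr (lt_trans h1).
  by have [mu _ _] := rQ u ur ut'; exact: mu.
rewrite /crossings; have [ts|ts] := boolP (t \in s).
  rewrite big_mkcond (bigD1_seq t ts us) /= xt lexx /= big1 ?addn0 // => u ut.
  by case: ifP => // xut; exact: small.
rewrite big_seq_cond big1 => [|u /andP[us' xut]].
  by apply/eqP; apply: contraNT ts; exact: sP.
by apply: small => //; apply: contraNneq ts => <-.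
Qed.

(** Angles e that avoid the spectrum at one point of the path do so around it. *)
Lemma partition_exists a b : a <= b -> exists N t e, maslov_partition W a b N t e.
Proof.
move=> ab; apply: (interval_induction (Q := fun x y =>
  exists N t e, maslov_partition W x y N t e)) ab _ _.
  move=> x y z _ _ _ _ [N1 [t1 [e1 [t10 t1N h1]]]] [N2 [t2 [e2 [t20 t2N h2]]]].
  exists (N1 + N2)%N, (fun j => if (j <= N1)%N then t1 j else t2 (j - N1)%N).
  exists (fun j => if (j < N1)%N then e1 j else e2 (j - N1)%N); split.
  - by [].
  - case: leqP => [|_]; last by rewrite addKn.
    rewrite -{2}[N1]addn0 leq_add2l leqn0 => /eqP N20.
    by rewrite N20 addn0 t1N -t20 -t2N N20.
  move=> j jN; case: (ltnP j N1) => jN1.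
    by rewrite (ltnW jN1); exact: h1.
  have jE : j = (N1 + (j - N1))%N by rewrite subnKC.
  have jN2 : (j - N1 < N2)%N by rewrite ltn_subLR.
  have -> : (if (j <= N1)%N then t1 j else t2 (j - N1)%N) = t2 (j - N1)%N.
    case: leqP => // jN1'; have -> : j = N1 by apply/eqP; rewrite eqn_leq jN1 jN1'.
    by rewrite subnn t20 t1N.
  by have := h2 _ jN2; rewrite -subSn.
move=> t _; have [e /andP[e0 epi] [t_unit t_unit']] := good_angle t.
have nu := near_angle_unit V_cont XZ_sol t_unit.
have nu' := near_angle_unit V_cont XZ_sol t_unit'.
have [r r0 rQ] := near_opp nu; have [r' r'0 rQ'] := near_opp nu'.
pose q := Num.min r r'; have q0 : 0 < q by rewrite lt_min r0.
have good u : `|u - t| < q ->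
    ~~ eigenvalue (W u) (expi (pi + e)) /\ ~~ eigenvalue (W u) (expi (pi - e)).
  rewrite lt_min => /andP[ur ur'].
  split; rewrite (path_matrix_eigenvalue V_cont V_sym a_lag b_lag a_norm b_norm XZ_sol).
    exact: rQ.
  exact: rQ'.
have part x y : x <= y -> (forall u, x <= u <= y -> `|u - t| < q) ->
    exists N tt ee, maslov_partition W x y N tt ee.
  rewrite le_eqVlt => /predU1P[-> _|xy near].
    by exists 0%N, (fun=> y), (fun=> e); split.
  exists 1%N, (fun j => if j is 0%N then x else y), (fun=> e); split=> //.
  by case=> // _; split; rewrite ?e0 // => u /near/good.
exists q => //; split=> x /andP[h1 h2] _; apply: part => // u /andP[h3 h4].
  by rewrite ger0_norm ?subr_ge0 // ltrBlDl (le_lt_trans h4).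
by rewrite ler0_norm ?subr_le0 // opprB ltrBlDl -ltrBlDr (lt_le_trans h1).
Qed.

(** The contributions [count_crossings] of the pieces of the partition add up. *)
Lemma maslov_sum_crossings s L N t e : uniq s ->
    (forall u, 0 < u -> mult (- u) != 0%N -> u \in s) ->
    maslov_partition W 0 L N t e ->
  maslov_sum W N t e = (crossings s 0 L)%:Z.
Proof.
move=> us sP [t0 tN tP]; rewrite /maslov_sum -tN.
have ge0 k : (k <= N)%N -> 0 <= t k.
  elim: k => [|k IH] kN; first by rewrite t0.
  by have [tk _ _] := tP k kN; rewrite (le_trans (IH (ltnW kN))) // ltW.
elim: N {tN} tP ge0 => [|N IH] tP ge0.
  rewrite big_ord0 t0 /crossings big1 // => u /andP[xu ux].
  by move: (lt_le_trans xu ux); rewrite ltxx.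
rewrite big_ord_recr /= IH; first last.
- by move=> k kN; apply: ge0; exact: leqW.
- by move=> j jN; apply: tP; exact: leqW.
have [tlt /andP[e0 epi] good] := tP N (ltnSn N).
rewrite (@crossings_cat s 0 (t N) (t N.+1) (ge0 _ (leqnSn N)) (ltW tlt)) PoszD.
congr (_ + _).
transitivity (count (e N) (- t N.+1) - count (e N) (- t N)).
  by congr (_ - _); exact: count_path.
apply: (count_crossings e0 epi (ltW tlt) _ us) => [u /good[+ _]|u tu].
  by rewrite (path_matrix_eigenvalue V_cont V_sym a_lag b_lag a_norm b_norm XZ_sol).
by apply: sP; apply: le_lt_trans tu; exact: ge0.
Qed.

End Flow.

Theorem lemma3p9 (R : realType) (n : nat) (n_gt0 : (0 < n)%N)
  (V : R -> 'M[R]_n)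
  (V_cont : {within `[(0 : R), 1], continuous V})
  (V_sym : forall x, x \in `[(0 : R), 1] -> (V x)^T = V x)
  (a1 a2 b1 b2 : 'M[R]_n)
  (a_rank : \rank (row_mx a1 a2) = n)
  (b_rank : \rank (row_mx b1 b2) = n)
  (a_lag : a1 *m a2^T - a2 *m a1^T = 0)
  (b_lag : b1 *m b2^T - b2 *m b1^T = 0)
  (a_norm : a1 *m a1^T + a2 *m a2^T = 1%:M)
  (b_norm : b1 *m b1^T + b2 *m b2^T = 1%:M)
  (X Z : R -> R -> 'M[R]_n)
  (XZ_sol : forall lam : R,
     frame_solution V a1 a2 lam (fun x => X x lam) (fun x => Z x lam)) :
  exists m : nat,
    is_morse_index (schrodinger V a1 a2 b1 b2) m /\
    exists L0 : R, 0 < L0 /\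
      forall L : R, L0 <= L ->
        is_maslov_index (path_matrix b1 b2 X Z (@Gamma3 R)) 0 L m%:Z.
Proof.
pose mult := multiplicity b1 b2 X Z.
have [L0 L0_gt0 below] := spectrum_bounded_below V_cont a_lag b_lag a_norm b_norm XZ_sol.
have mult0 lam : lam <= - L0 -> mult lam = 0%N.
  move=> lamL; have unit_bd : boundary b1 b2 X Z lam \in unitmx.
    by apply: unitmx_col_inj => v; exact: below.
  exact: multiplicity_unit.
have [s1 s1P] := crossings_finite V_cont V_sym a_lag b_lag a_norm b_norm XZ_sol (ltW L0_gt0).
pose s := undup [seq t <- s1 | (0 < t) && (mult (- t) != 0%N)].
have us : uniq s by exact: undup_uniq.
have sE t : (t \in s) = (0 < t) && (mult (- t) != 0%N).
  rewrite mem_undup mem_filter andb_idr // => /andP[t0 mt].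
  apply: s1P => //; rewrite ltW //= leNgt; apply: contraNN mt => L0t.
  by rewrite mult0 // lerN2 ltW.
have s_pos t : 0 < t -> mult (- t) != 0%N -> t \in s by move=> t0 mt; rewrite sE t0.
exists (\sum_(t <- s) mult (- t))%N; split.
  exists [seq - t | t <- s], mult; split.
  - by rewrite map_inj_uniq //; exact: oppr_inj.
  - move=> lam; have ev := is_eigenvalue_boundary b1 b2 V_cont a_lag a_norm XZ_sol lam.
    split=> [/mapP[t + ->]|[lam0 /ev mlam]].
      by rewrite sE oppr_lt0 => /andP[t0 mt]; split=> //; apply/(is_eigenvalue_boundary b1 b2 V_cont a_lag a_norm XZ_sol).
    by apply/mapP; exists (- lam); rewrite ?opprK // sE oppr_gt0 opprK lam0.
  - by move=> lam _; exact: (has_multiplicity_boundary b1 b2 V_cont a_lag a_norm XZ_sol).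
  - by rewrite big_map.
exists L0; split=> // L L0L; have L_ge0 : 0 <= L by apply: le_trans L0L; exact: ltW.
split; first exact: (partition_exists V_cont V_sym a_lag b_lag a_norm b_norm XZ_sol).
move=> N t e te_part.
rewrite (maslov_sum_crossings V_cont V_sym a_lag b_lag a_norm b_norm XZ_sol us s_pos te_part).
congr Posz; rewrite /crossings [LHS]big_seq_cond [RHS]big_seq_cond; apply: eq_bigl => u.
rewrite andbT andb_idr // sE => /andP[-> mu] /=; rewrite leNgt.
by apply: contraNN mu => Lu; rewrite mult0 // lerN2 (le_trans L0L) // ltW.
Qed.
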